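(* Let $d,m\in\mathbb{N}$, $N=2^m$, let $\boldsymbol{w}=(w_j)_{j\ge1}$ be a sequence in $\mathbb{N}_0$ with $0=w_1\le w_2\le\cdots$, and let $\boldsymbol{\gamma}=(\gamma_j)_{j\ge1}$ be positive product weights. Denote by $\boldsymbol{z}=(Y_1z_1,\ldots,Y_dz_d)$ the corresponding generating vector constructed by the reduced CBC-DBD algorithm. Then $$T_{\boldsymbol{\gamma}}(N,\boldsymbol{z},\boldsymbol{w})\le\sum_{\emptyset\neq\mathfrak{u}\subseteq[d^*]}\gamma_{\mathfrak{u}}\,\frac{2\,(6\log N)^{|\mathfrak{u}|+1}}{2^{m-\max_{j\in\mathfrak{u}}w_j}}.$$
   Context: Notation: $\mathbb{N}=\{1,2,\ldots\}$, $\mathbb{N}_0=\{0,1,\ldots\}$, $[d]=\{1,\ldots,d\}$, $\log$ is the natural logarithm, $Y_j:=2^{w_j}$, $d^*:=\max\{j\in[d]:w_j<m\}$, product weights means $\gamma_{\mathfrak{u}}:=\prod_{j\in\mathfrak{u}}\gamma_j$ with $\gamma_\emptyset=1$. For $a\in\mathbb{Z}$, $\delta_N(a)=1$ if $a\equiv0\pmod N$ and $\delta_N(a)=0$ otherwise. For $\boldsymbol{\ell}\in\mathbb{Z}^d$, $r_{1,\boldsymbol{\gamma}}(\boldsymbol{\ell}):=\prod_{j\in[d],\,\ell_j\neq0}\gamma_j^{-1}|\ell_j|$. $M_{N,d,\boldsymbol{w}}:=\prod_{j=1}^dM_{N,j,w_j}$ (Cartesian product) with $M_{N,j,w_j}:=\{-(2^{\max(0,m-w_j)}-1),\ldots,2^{\max(0,m-w_j)}-1\}\subset\mathbb{Z}$.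 The quality measure is $$T_{\boldsymbol{\gamma}}(N,\boldsymbol{z},\boldsymbol{w}):=\sum_{\boldsymbol{0}\neq\boldsymbol{\ell}\in M_{N,d,\boldsymbol{w}}}\frac{\delta_N(\boldsymbol{\ell}\cdot\boldsymbol{z})}{r_{1,\boldsymbol{\gamma}}(\boldsymbol{\ell})}.$$ Quality function: for $1\le s\le d^*$, $1\le v\le m-w_s$, odd $x\in\mathbb{N}$ and given odd $z_1,\ldots,z_{s-1}$ with $z_j\in\{1,3,\ldots,2^{m-w_j}-1\}$, $$h_{s,v,m,\boldsymbol{\gamma},\boldsymbol{w}}(x):=\sum_{t=v}^{m-w_s}\frac{1}{2^{t-v}}\sum_{\ell=0}^{2^{w_s}-1}\ \sum_{\substack{k=\ell2^t+1 \\ k\ \mathrm{odd}}}^{(\ell+1)2^t-1}\ \sum_{\substack{\mathfrak{u}\subseteq[s] \\ s\in\mathfrak{u}}}\gamma_{\mathfrak{u}\setminus\{s\}}\prod_{\substack{j\in\mathfrak{u} \\ j\neq s}}\log\left(\frac{1}{\sin^2\left(\pi z_j\frac{k}{2^t}\frac{2^{m-w_s}}{2^{m-w_j}}\right)}\right)\left(1+\gamma_s\log\left(\frac{1}{\sin^2(\pi kx/2^v)}\right)\right).$$ Reduced CBC-DBD algorithm (input $m,d,\boldsymbol{w},\boldsymbol{\gamma}$): set $z_1=1$, and set $z_j=1$ for $d^*<j\le d$. For $s=2,\ldots,d^*$ successively: set $z_{s,1}=1$; for $v=2,\ldots,m-w_s$ successively, let $z^*\in\{0,1\}$ be a minimizer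 of $z\mapsto h_{s,v,m,\boldsymbol{\gamma},\boldsymbol{w}}(z_{s,v-1}+z2^{v-1})$ over $\{0,1\}$ (computed with the already determined $z_1,\ldots,z_{s-1}$) and set $z_{s,v}=z_{s,v-1}+z^*2^{v-1}$; finally set $z_s=z_{s,m-w_s}$. Output $\boldsymbol{z}=(Y_1z_1,\ldots,Y_dz_d)$. *)

(* Defs.v *)
From HB Require Import structures.
From mathcomp Require Import all_boot all_order all_algebra.
From mathcomp Require Import all_classical all_reals all_analysis.

Set Implicit Arguments.
Unset Strict Implicit.
Unset Printing Implicit Defensive.

Import Order.TTheory GRing.Theory Num.Theory.

Local Open Scope classical_set_scope.
Local Open Scope ring_scope.

(* Coordinates and sequences are indexed from 0: [w j], [gamma j] and [z j]
   stand for w_{j+1}, gamma_{j+1} and z_{j+1}, and the index set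
   [n] = {1, ..., n} is 'I_n. *)

(* d^* = max {j in [d] : w_j < m}; the 1-based value of the index j is j.+1. *)
Definition dstar (m d : nat) (w : nat -> nat) : nat :=
  (\max_(j < d | (w j < m)%N) j.+1)%N.

Definition prod_weight (R : realType) (gamma : nat -> R) (n : nat)
    (u : {set 'I_n}) : R :=
  \prod_(j in u) gamma j.

(* M_{N,d,w} for N = 2^m.  The truncated difference m - w j is
   max(0, m - w_j). *)
Definition freq_box (m d : nat) (w : nat -> nat) : set {ffun 'I_d -> int} :=
  [set l | forall j : 'I_d,
     - (2 ^+ (m - w j) - 1) <= l j <= 2 ^+ (m - w j) - 1 ].

(* A sum over a set with infinite support would be 0 by convention; the sum
   defining [quality_T] is a genuine one because its index set is finite. *)
Lemma finite_freq_box (m d : nat) (w : nat -> nat) :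
  finite_set (freq_box m (d := d) w).
Proof.
pose g (f : {ffun 'I_d -> bool * 'I_(2 ^ m).+1}) : {ffun 'I_d -> int} :=
  [ffun j => (-1) ^+ (f j).1 * (f j).2%:Z].
apply: (@sub_finite_set _ _ (g @` setT)); last first.
  by apply: finite_image; exact: finite_finset.
move=> l /= lP.
exists [ffun j => (l j < 0, inord `|l j|%N)] => //.
apply/ffunP => j; rewrite !ffunE /= inordK ?abszE; last first.
  rewrite ltnS -lez_nat abszE ler_norml.
  have {lP} /andP[lo hi] := lP j.
  have le2 : 2 ^+ (m - w j) - 1 <= (2 ^ m)%N%:Z.
    rewrite (@le_trans _ _ (2 ^+ (m - w j))) ?gerBl//.
    by rewrite -natz natrX ler_eXn2l ?leq_subr.
  by rewrite (le_trans hi le2) andbT (le_trans _ lo)// lerN2.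
by rewrite -intEsign.
Qed.

Definition r1 (R : realType) (d : nat) (gamma : nat -> R)
    (l : {ffun 'I_d -> int}) : R :=
  \prod_(j < d | l j != 0) ((gamma j)^-1 * `|l j|%:~R).

Definition delta (R : realType) (N : nat) (a : int) : R :=
  if (N%:Z %| a)%Z then 1 else 0.

(* T_gamma(N, z, w) for N = 2^m, as a sum over M_{N,d,w} without the zero
   vector. *)
Definition quality_T (R : realType) (m d : nat) (gamma : nat -> R)
    (z : 'I_d -> nat) (w : nat -> nat) : R :=
  \sum_(l \in freq_box m w `\ 0)
    (delta R (2 ^ m) (\sum_(j < d) l j * (z j)%:Z) / r1 gamma l).

(* h_{s+1,v,m,gamma,w}(x): the coordinate under construction has 0-based index
   [s], is the element [ord_max] of 'I_s.+1, and only z 0, ..., z (s-1) are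
   used.  It is only evaluated for s < d^*, so that, w being nondecreasing,
   m - w s and all m - w j are true differences. *)
Definition quality_h (R : realType) (m : nat) (gamma : nat -> R)
    (w z : nat -> nat) (s v x : nat) : R :=
  \sum_(v <= t < (m - w s).+1)
    1 / 2 ^+ (t - v) *
    \sum_(0 <= l < 2 ^ w s)
      \sum_(l * 2 ^ t + 1 <= k < l.+1 * 2 ^ t | odd k)
        \sum_(u : {set 'I_s.+1} | ord_max \in u)
          prod_weight gamma (u :\ ord_max) *
          (\prod_(j in u | j != ord_max)
             ln (1 / sin (pi * (z j)%:R * (k%:R / 2 ^+ t) *
                          (2 ^+ (m - w s) / 2 ^+ (m - w j))) ^+ 2)) *
          (1 + gamma s * ln (1 / sin (pi * k%:R * x%:R / 2 ^+ v) ^+ 2)).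

(* One run of the inner (digit-by-digit) loop for the coordinate of index [s]:
   [zs v] is z_{s,v} and [b] is z^*.  When both digits minimize h, either choice
   is allowed. *)
Definition dbd_run (R : realType) (m : nat) (gamma : nat -> R)
    (w z : nat -> nat) (s : nat) (zs : nat -> nat) : Prop :=
  zs 1%N = 1%N /\
  forall v : nat, (2 <= v <= m - w s)%N ->
    exists b : bool,
      (forall b' : bool,
         quality_h m gamma w z s v (zs v.-1 + b * 2 ^ v.-1)
         <= quality_h m gamma w z s v (zs v.-1 + b' * 2 ^ v.-1)) /\
      zs v = (zs v.-1 + b * 2 ^ v.-1)%N.

(* [z] is a possible sequence of components z_1, ..., z_d computed by the
   reduced CBC-DBD algorithm (its values at indices >= d are irrelevant). *)
Definition reduced_cbc_dbd (R : realType) (m d : nat) (gamma : nat -> R)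
    (w z : nat -> nat) : Prop :=
  [/\ z 0%N = 1%N,
      forall j : nat, (dstar m d w <= j < d)%N -> z j = 1%N
    & forall s : nat, (1 <= s < dstar m d w)%N ->
        exists zs : nat -> nat,
          dbd_run m gamma w z s zs /\ z s = zs (m - w s)%N].

Definition generating_vector (d : nat) (w z : nat -> nat) : 'I_d -> nat :=
  fun j => (2 ^ w j * z j)%N.

(* Main.v *)
Require Import Defs.
From HB Require Import structures.
From mathcomp Require Import all_boot all_order all_algebra.
From mathcomp Require Import all_classical all_reals all_analysis.
From mathcomp Require Import complex ring lra zify.

Set Implicit Arguments.
Unset Strict Implicit.
Unset Printing Implicit Defensive.

Import Order.TTheory GRing.Theory Num.Theory numFieldNormedType.Exports.
Local Open Scope ring_scope.

(** Why the bound holds.  Write N = 2^m, n_j = m - w_j and, for a residue k modulo N,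
L_j(k) = ln (1 / sin^2 (pi k z_j / 2^n_j)).

Expanding the congruence indicator of T in additive characters modulo N turns
1 + T into the average over k of the product over j of 1 + gamma_j F_j(k), where
F_j(k) is the sum of cos (2 pi l k z_j / 2^n_j) / |l| over 0 < |l| < 2^n_j.
Coordinates with w_j >= m have F_j = 0 and drop out.  The function F_j + ln 4 is
a truncation of the Fourier series of L_j.  Replacing F_j by F_j + ln 4 only
adds nonnegative Fourier coefficients, and the zero frequency pays for the
subtraction of the product of the 1 + gamma_j ln 4.  After expansion over the
subsets u of {1, ..., d^*}, T is at most the sum over nonempty u of gamma_u
times the average over k of the product over u of F_j + ln 4, minus (ln 4)^|u|
([quality_T_le_trunc]).

Undoing the truncation costs 2 (6 ln N)^(|u|+1) / 2^n_u for each u, where n_u is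
the smallest n_j ([trunc_product_bound]).  The residues divisible by 2^n_u,
where some L_j may be singular, have density 1 / 2^n_u, and each factor there is
at most B = 2 m + ln 4.  At the other residues the truncation error is at most
4 / (2^n_j |sin|), by a comparison of derivatives
([cos_sum_corrected_monotone]), and the reciprocals of the sines average to a
harmonic sum.  The error of a product of |u| factors carries a factor |u|, which
is absorbed because B is smaller than 6 ln N by a multiple of m.

What remains is to see that the products of the L_j are compensated by the
powers of ln 4 ([log_products_bound]), and this is what the algorithm achieves.
The identity L(x) + L(x + pi / 2) = ln 4 + L(2 x) for L(x) = ln (1 / sin^2 x)
says that the mean over the two candidate digits at stage v is half of ln 4 plus
the value at stage v - 1.  A minimizing digit does no worse than the mean, and
the weights 1 / 2^(t-v) in h make these inequalities telescope over v
([digit_potential]).  Hence adding the coordinate s multiplies the running sum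
of products of the 1 + gamma_j L_j by at most 1 + gamma_s ln 4
([prefix_sum_bound]), and grouping the subsets u by their maximum s yields the
claim. *)

(** * Harmonic sums and ln 2 *)

(** Each dyadic block 2^i <= l < 2^(i+1) contributes at most 1. *)
Lemma harmonic_pow2 (R : realType) (n : nat) :
  \sum_(1 <= l < 2 ^ n) (l%:R^-1 : R) <= n%:R.
Proof.
elim: n => [|n IH]; first by rewrite expn0 big_geq.
rewrite (big_cat_nat (n := (2 ^ n)%N)) ?expn_gt0 ?leq_exp2l //= -natr1.
apply: lerD => //.
apply: (@le_trans _ _ (\sum_(2 ^ n <= l < 2 ^ n.+1) (2 ^ n)%:R^-1)); last first.
  rewrite sumr_const_nat expnS mul2n -addnn addnK -[leLHS]mulr_natl mulfV //.
apply: ler_sum_nat => l /andP[lo _].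
by rewrite lef_pV2 ?posrE ?ltr0n ?ler_nat ?expn_gt0 // (leq_trans _ lo) // expn_gt0.
Qed.

Lemma ln_succ (R : realType) (l : nat) : (0 < l)%N ->
  l.+1%:R^-1 <= ln (l.+1%:R : R) - ln l%:R <= l%:R^-1.
Proof.
move=> l0; have l0R : (0 : R) < l%:R by rewrite ltr0n.
have l1R : (0 : R) < l.+1%:R by rewrite ltr0n.
apply/andP; split.
- have := @le_ln1Dx R (- l.+1%:R^-1) _.
  have -> : 1 - l.+1%:R^-1 = l%:R / l.+1%:R :> R.
    by rewrite -natr1; field; rewrite natr1 lt0r_neq0.
  rewrite ln_div ?posrE // => h; rewrite -lerN2 opprB; apply: h.
  by rewrite ltrN2 invf_lt1 // ltr1n.
- have := @le_ln1Dx R (l%:R^-1) _.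
  have -> : 1 + l%:R^-1 = l.+1%:R / l%:R :> R.
    by rewrite -natr1; field; rewrite lt0r_neq0.
  rewrite ln_div ?posrE //; apply.
  by apply: (@lt_trans _ _ 0) => //; rewrite invr_gt0.
Qed.

Lemma ln2_telescope (R : realType) (p : nat) : (0 < p)%N ->
  ln (2 : R) = \sum_(p <= l < p.*2) (ln (l.+1%:R : R) - ln l%:R).
Proof.
move=> p0; rewrite telescope_sumr; last by rewrite -addnn leq_addr.
by rewrite -mul2n natrM lnM ?posrE ?ltr0n // addrK.
Qed.

Lemma ln2_le_harmonic (R : realType) (p : nat) : (0 < p)%N ->
  ln 2 <= \sum_(p <= l < p.*2) (l%:R^-1 : R).
Proof.
move=> p0; rewrite (ln2_telescope _ p0); apply: ler_sum_nat => l /andP[lo _].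
by have /andP[] := @ln_succ R l (leq_trans p0 lo).
Qed.

Lemma harmonic_le_ln2 (R : realType) (p : nat) : (0 < p)%N ->
  \sum_(p <= l < p.*2) (l.+1%:R^-1 : R) <= ln 2.
Proof.
move=> p0; rewrite (ln2_telescope _ p0); apply: ler_sum_nat => l /andP[lo _].
by have /andP[] := @ln_succ R l (leq_trans p0 lo).
Qed.

Lemma harmonic_block_le_ln2 (R : realType) (p : nat) : (0 < p)%N ->
  \sum_(p <= l < p.*2) (l%:R^-1 : R) <= ln 2 + (p.*2%:R)^-1.
Proof.
move=> p0; have := harmonic_le_ln2 R p0.
have -> : \sum_(p <= l < p.*2) (l.+1%:R^-1 : R)
  = \sum_(p.+1 <= l < (p.*2).+1) (l%:R^-1 : R) by rewrite big_add1.
have lt : (p < p.*2)%N by rewrite -addnn -[X in (X < _)%N]addn0 ltn_add2l.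
rewrite [X in _ -> X <= _](big_ltn lt) [X in X <= _ -> _]big_nat_recr //=.
have -> : (p%:R : R)^-1 = (p.*2%:R)^-1 + (p.*2%:R)^-1.
  by rewrite -mul2n natrM; field; rewrite pnatr_eq0 -lt0n.
lra.
Qed.

(** The block 1/11 + ... + 1/20 already exceeds 2/3. *)
Lemma ln2_ge (R : realType) : 2 / 3 <= ln 2 :> R.
Proof.
apply: le_trans (@harmonic_le_ln2 R 10 isT).
rewrite unlock /=. lra.
Qed.

Lemma ln2_le1 (R : realType) : ln 2 <= 1 :> R.
Proof. by have := @ln2_le_harmonic R 1 isT; rewrite big_nat1 invr1. Qed.

(** * Truncating the Fourier series of the log-sine *)

(** The Fourier series of - ln (2 |sin x|), cut off at M. *)
Definition cos_sum (R : realType) (M : nat) (x : R) : R :=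
  \sum_(1 <= l < M) cos (l%:R * (2 * x)) / l%:R.

Lemma is_derive_cos_sum (R : realType) (M : nat) (x : R) :
  is_derive x 1 (cos_sum M) (- 2 * \sum_(1 <= l < M) sin (l%:R * (2 * x))).
Proof.
elim: M => [|[|M] IH].
- have -> : @cos_sum R 0 = cst 0.
    by apply/funext => y; rewrite /cos_sum big_geq.
  by rewrite big_geq // mulr0; exact: is_derive_cst.
- have -> : @cos_sum R 1 = cst 0.
    by apply/funext => y; rewrite /cos_sum big_geq.
  by rewrite big_geq // mulr0; exact: is_derive_cst.
have dg : is_derive x 1 (cos \o ( *:%R (M.+1%:R * 2 : R)))
   (- sin (M.+1%:R * 2 * x) * (M.+1%:R * 2)).
  apply: is_derive1_comp.
  by apply: is_derive_eq; rewrite /GRing.scale /= mulr1.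
have -> : @cos_sum R M.+2 = cos_sum M.+1 +
   (M.+1%:R^-1 *: (cos \o ( *:%R (M.+1%:R * 2))) : R -> R).
  apply/funext => y; rewrite /cos_sum big_nat_recr //=; congr (_ + _).
  by rewrite /GRing.scale /= mulrC mulrA.
apply: (is_derive_eq (is_deriveD IH (is_deriveZ _ dg))).
rewrite [in RHS]big_nat_recr //= [RHS]mulrDr; congr (_ + _).
rewrite /GRing.scale /= -mulrA.
by field; rewrite nat1r pnatr_eq0.
Qed.

(** The conjugate Dirichlet kernel, by telescoping. *)
Lemma sin_mul_sin_sum (R : realType) (M : nat) (x : R) :
  sin x * (2 * \sum_(1 <= l < M.+1) sin (l%:R * (2 * x))) =
  cos x - cos (M.*2.+1%:R * x).
Proof.
elim: M => [|M IH]; first by rewrite big_geq // !mulr0 mul1r subrr.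
rewrite big_nat_recr //= [2 * _]mulrDr mulrDr IH.
have -> : (M.*2.+1%:R : R) * x = M.+1%:R * (2 * x) - x.
  by rewrite -mul2n -natr1 natrM -[M.+1%:R]natr1; ring.
have -> : (M.+1.*2.+1%:R : R) * x = M.+1%:R * (2 * x) + x.
  by rewrite -mul2n -natr1 natrM; ring.
rewrite cosB cosD; ring.
Qed.

(** The derivative of cos_sum + ln sin is the oscillating function
cos (q x) / sin x, where q = 2 M + 1.  Subtracting sin (q x) / (q sin x), an
approximate primitive of it, leaves a derivative bounded by that of
1 / (q sin x) up to sign; the term with c adds a multiple of the latter. *)
Lemma is_derive_cos_sum_corrected (R : realType) (M : nat) (c x : R) : sin x > 0 ->
  is_derive x 1 (cos_sum M.+1 + (@ln R \o sin) +
      (M.*2.+1%:R^-1 *: ((cst c - (sin \o ( *:%R (M.*2.+1%:R : R)))) *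
        (fun y => (sin y)^-1))) : R -> R)
    ((sin (M.*2.+1%:R * x) - c) * cos x / (M.*2.+1%:R * sin x ^+ 2)).
Proof.
move=> sx; set q : R := M.*2.+1%:R.
have q0 : q != 0 by rewrite /q pnatr_eq0.
have dS := is_derive_cos_sum M.+1 x.
have dl : is_derive x 1 (@ln R \o sin) ((sin x)^-1 * cos x).
  by apply: is_derive1_comp; exact: is_derive1_ln.
have dq : is_derive x 1 (sin \o ( *:%R q)) (cos (q * x) * q).
  by apply: is_derive1_comp; apply: is_derive_eq; rewrite /GRing.scale /= mulr1.
have dV : is_derive x 1 (fun y : R => (sin y)^-1) (- sin x ^- 2 *: cos x).
  by apply: is_deriveV; rewrite gt_eqF.
apply: (is_derive_eq (is_deriveD (is_deriveD dS dl)
  (is_deriveZ q^-1 (is_deriveM (is_deriveB (is_derive_cst c x 1) dq) dV)))).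
have -> : - 2 * \sum_(1 <= l < M.+1) sin (l%:R * (2 * x)) =
   (cos (q * x) - cos x) / sin x.
  by rewrite -opprB -(sin_mul_sin_sum M x); field; rewrite gt_eqF.
rewrite /GRing.scale /= /GRing.scale !fctE /=; field.
by rewrite gt_eqF //= nat1r pnatr_eq0.
Qed.

Lemma cos_natpi (R : realType) (a : nat) : cos (a%:R * pi) = (-1) ^+ a :> R.
Proof. by rewrite mulr_natl -[_ *+ _]add0r (alternatingn (@cosDpi R)) cos0 mulr1. Qed.

(** The factor sin (q z) - c of the derivative keeps its sign once |c| >= 1.
The cases c = 1 and c = -1 confine the truncation error between quantities that
involve only its value at pi / 2 and 1 / (q sin x). *)
Lemma cos_sum_corrected_monotone (R : realType) (M : nat) (c x y : R) :
  0 < x -> x <= y -> y <= pi / 2 ->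
  let f z := cos_sum M.+1 z + ln (sin z) +
     (c - sin (M.*2.+1%:R * z)) / (M.*2.+1%:R * sin z) in
  (1 <= c -> f y <= f x) /\ (c <= -1 -> f x <= f y).
Proof.
move=> x0 xy yp f.
have fE : f = cos_sum M.+1 + (@ln R \o sin) +
      (M.*2.+1%:R^-1 *: ((cst c - (sin \o ( *:%R (M.*2.+1%:R : R)))) *
        (fun y => (sin y)^-1))) :> (R -> R).
  apply/funext => z; rewrite /f !fctE /= /GRing.scale /=; congr (_ + _).
  by rewrite invfM mulrCA.
have q0 : (0 : R) < M.*2.+1%:R by rewrite ltr0n.
have s0 z : x <= z -> z <= y -> 0 < sin z.
  move=> xz zy; apply: sin_gt0_pi; rewrite (lt_le_trans x0 xz) /=.
  have := pi_gt0 R; lra.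
have df z : x <= z -> z <= y -> is_derive z 1 f
    ((sin (M.*2.+1%:R * z) - c) * cos z / (M.*2.+1%:R * sin z ^+ 2)).
  by move=> xz zy; rewrite fE; apply: is_derive_cos_sum_corrected; exact: s0.
have cz z : x <= z -> z <= y -> 0 <= cos z.
  move=> xz zy; apply: cos_ge0_pihalf; have := pi_gt0 R; lra.
have cf : {within `[x, y], continuous f}%classic.
  apply: derivable_within_continuous => z; rewrite in_itv /= => /andP[xz zy].
  by have [] := df z xz zy.
have dfo z : z \in `]x, y[ -> derivable f z 1.
  by rewrite in_itv /= => /andP[xz zy]; have [] := df z (ltW xz) (ltW zy).
split=> hc.
- apply: (ler0_derive1_nincr dfo) cf _ _ _ _ _ => // z.
  rewrite in_itv /= => /andP[/ltW xz /ltW zy].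
  rewrite derive1E (@derive_val _ _ _ _ _ _ _ (df z xz zy)).
  rewrite mulr_le0_ge0 //; last first.
    by rewrite invr_ge0 mulr_ge0 ?exprn_ge0 // ltW // s0.
  rewrite mulr_le0_ge0 ?cz // subr_le0.
  exact: le_trans (sin_le1 _) hc.
- apply: (ger0_derive1_ndecr dfo) cf _ _ _ _ _ => // z.
  rewrite in_itv /= => /andP[/ltW xz /ltW zy].
  rewrite derive1E (@derive_val _ _ _ _ _ _ _ (df z xz zy)).
  rewrite mulr_ge0 //; last first.
    by rewrite invr_ge0 mulr_ge0 ?exprn_ge0 // ltW // s0.
  rewrite mulr_ge0 ?cz // subr_ge0.
  exact: le_trans hc (sin_geN1 _).
Qed.

(** The alternating harmonic sum is a block of the harmonic sum, which is close
to ln 2. *)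
Lemma cos_sum_pihalf (R : realType) (p : nat) : (0 < p)%N ->
  cos_sum p.*2 (pi / 2) = - \sum_(p <= l < p.*2) l%:R^-1 :> R.
Proof.
have E n : cos_sum n (pi / 2) = \sum_(1 <= l < n) (-1) ^+ l / l%:R :> R.
  apply: eq_bigr => l _; congr (_ / _).
  have -> : 2 * (pi / 2) = pi :> R by field.
  exact: cos_natpi.
have step a : (0 < a)%N -> \sum_(a.+1 <= l < a.*2.+2) (l%:R^-1 : R) =
    \sum_(a <= l < a.*2) l%:R^-1 - a.*2%:R^-1 + a.*2.+1%:R^-1.
  move=> a0; have lt : (a < a.*2)%N by rewrite -addnn -[X in (X < _)%N]addn0 ltn_add2l.
  rewrite [in RHS](big_ltn lt) big_nat_recr ?ltnS ?(ltnW lt) //= big_nat_recr //=.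
  have -> : (a%:R : R)^-1 = a.*2%:R^-1 + a.*2%:R^-1.
    by rewrite -mul2n natrM; field; rewrite pnatr_eq0 -lt0n.
  ring.
rewrite E; elim: p => [//|[|p] IH _].
  by rewrite doubleS !big_nat1 expr1 invr1 mulN1r.
rewrite doubleS step //; move: IH => /(_ isT).
have : (0 < p.+1.*2)%N by rewrite double_gt0.
have : odd p.+1.*2 = false by rewrite odd_double.
move: p.+1.*2 p.+1 => b a ob b0 IH.
rewrite !big_nat_recr //= IH exprS -signr_odd ob expr0; ring.
Qed.

(** At pi / 2 the error is ln 2 minus a harmonic block; monotonicity carries
this estimate to x.  At the grid points sin (q x) = - sin x for q = 2 M - 1, so
that the correction sin (q x) / (q sin x) is the constant - 1 / q. *)
Lemma cos_sum_ln_sin_error (R : realType) (p r : nat) : (0 < r <= p)%N ->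
  let s := sin (pi * (r%:R / p.*2%:R)) : R in
  0 < s /\
  `|cos_sum p.*2 (pi * (r%:R / p.*2%:R)) + ln s + ln 2| <= 2 / (p.*2%:R * s).
Proof.
case/andP=> r0 rp; set x : R := pi * _; set M := p.*2; set q := M.-1.*2.+1.
have p0 : (0 < p)%N by exact: leq_trans r0 rp.
have MS : M = M.-1.+1 by rewrite prednK // double_gt0.
have M0 : (0 : R) < M%:R by rewrite ltr0n double_gt0.
have pi0 := pi_gt0 R.
have M2 : (M%:R : R) = 2 * p%:R by rewrite /M -mul2n natrM.
have x0 : 0 < x by rewrite /x mulr_gt0 // divr_gt0 // ltr0n.
have xp : x <= pi / 2.
  rewrite /x ler_pM2l // ler_pdivrMr // M2 mulrA mulVf ?mul1r ?ler_nat //.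
have s0 : 0 < sin x by apply: sin_gt0_pi; rewrite x0 /=; lra.
move=> s; split => //.
have qE : (q%:R : R) = 2 * M%:R - 1.
  have MR : (M%:R : R) = M.-1%:R + 1 by rewrite natr1 -MS.
  by rewrite /q -mul2n -natr1 natrM MR; ring.
have qM : (M%:R : R) <= q%:R.
  have p1 : (1 : R) <= p%:R by rewrite ler1n.
  rewrite qE M2; lra.
have sq : sin (q%:R * x) = - sin x.
  have -> : q%:R * x = - x + (pi : R) *+ 2 *+ r.
    rewrite qE /x -/M -(mulr_natl (pi *+ 2) r); move: (M%:R : R) M0 => c c0.
    by field; rewrite gt_eqF.
  by rewrite (periodicn (@sinD2pi R)) sinN.
have sq2 : sin (q%:R * (pi / 2)) = -1 :> R.
  rewrite (_ : q%:R * (pi / 2) = - (pi / 2) + pi *+ 2 *+ p); last first.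
    by rewrite qE M2 -(mulr_natl (pi *+ 2) p); move: (p%:R : R) => c; field.
  by rewrite (periodicn (@sinD2pi R)) sinN sin_pihalf.
have lnH := ln2_le_harmonic R p0; have lnH' := harmonic_block_le_ln2 R p0.
have q0 : (0 : R) < q%:R by rewrite ltr0n.
have [up _] := @cos_sum_corrected_monotone R M.-1 1 _ _ x0 xp (lexx _).
have [_ lo] := @cos_sum_corrected_monotone R M.-1 (-1) _ _ x0 xp (lexx _).
move: (up (lexx _)) (lo (lexx _)) => {up lo}.
rewrite -MS -/q sq sq2 cos_sum_pihalf // sin_pihalf ln1 -/s -/M.
have -> : (1 - - s) / (q%:R * s) = (q%:R * s)^-1 + q%:R^-1.
  by field; rewrite !gt_eqF.
have -> : (-1 - - s) / (q%:R * s) = q%:R^-1 - (q%:R * s)^-1.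
  by field; rewrite !gt_eqF.
have -> : (1 - - 1) / (q%:R * 1) = 2 * q%:R^-1 :> R by field; rewrite gt_eqF.
rewrite (_ : -1 - - 1 = 0 :> R) ?mul0r; last by ring.
have h1 : (q%:R * s)^-1 <= (M%:R * s)^-1.
  by rewrite lef_pV2 ?posrE ?mulr_gt0 // ler_pM2r.
have h2 : (M%:R)^-1 <= (M%:R * s)^-1.
  by rewrite lef_pV2 ?posrE ?mulr_gt0 // ger_pMr // sin_le1.
have h3 : (0 : R) < q%:R^-1 by rewrite invr_gt0.
move=> up lo; rewrite -/M in lnH'; rewrite ler_norml.
move: (cos_sum M x) (ln s) (q%:R^-1 : R) (ln 2 : R) (\sum_(p <= l < M) _)
  lnH lnH' up lo h1 h2 h3.
move: (q%:R * s)^-1 (M%:R * s)^-1 (M%:R^-1) => a b c S l q' l2 A.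
move=> *; lra.
Qed.

(** * Sines and log-sines at dyadic angles *)

(** Jordan's inequality on a grid: by the addition formulas the sequence
sin (k pi / (2 p)) is concave for k <= p, so its slopes from the origin
decrease down to the value 1 / p at k = p. *)
Lemma sin_grid_ge (R : realType) (p r : nat) : (0 < r <= p)%N ->
  (r%:R / p%:R : R) <= sin (pi * (r%:R / p.*2%:R)).
Proof.
case/andP=> r0 rp; have p0 : (0 < p)%N by exact: leq_trans r0 rp.
have p0R : (0 : R) < p%:R by rewrite ltr0n.
have pi0 := pi_gt0 R.
pose b k : R := sin (k%:R * (pi / (2 * p%:R))).
have bE k : sin (pi * (k%:R / p.*2%:R)) = b k.
  by rewrite /b -mul2n natrM mulrCA mulrA.
have b_ge0 k : (k <= p)%N -> 0 <= b k.
  move=> kp; apply: sin_ge0_pi; apply/andP; split.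
    by rewrite mulr_ge0 ?ler0n // divr_ge0 ?mulr_ge0 // ltW.
  rewrite mulrA ler_pdivrMr ?mulr_gt0 // mulrC ler_pM2l //.
  have : (k%:R : R) <= p%:R by rewrite ler_nat.
  lra.
have concave k : b k.+2 + b k <= 2 * b k.+1 \/ (p < k.+1)%N.
  have [kp|] := leqP k.+1 p; [left | by right].
  have -> : b k.+2 + b k = 2 * cos (pi / (2 * p%:R)) * b k.+1.
    rewrite /b -[k.+2]addn1 natrD.
    have -> : (k.+1%:R + 1%:R) * (pi / (2 * p%:R)) =
      k.+1%:R * (pi / (2 * p%:R)) + pi / (2 * p%:R) :> R by ring.
    have -> : k%:R * (pi / (2 * p%:R)) =
      k.+1%:R * (pi / (2 * p%:R)) - pi / (2 * p%:R) :> R.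
      by rewrite -[k.+1%:R]natr1; ring.
    by rewrite sinD sinB; ring.
  by rewrite ler_wpM2r ?b_ge0 // ler_piMr // cos_le1.
have slope k : (k < p)%N -> k%:R * b k.+1 <= k.+1%:R * b k.
  elim: k => [|k IH] kp; first by rewrite mul0r mulr_ge0 ?b_ge0.
  have {}IH := IH (ltnW kp).
  case: (concave k) => [h|]; last by rewrite ltnNge ltnW.
  have k1 : (0 : R) < k.+1%:R by rewrite ltr0n.
  have : k.+1%:R * b k.+2 <= k.+1%:R * (2 * b k.+1 - b k).
    by rewrite ler_pM2l //; lra.
  by move: IH; rewrite -![in X in _ -> X](natr1) -[k.+1%:R]natr1; nra.
have main k : (k <= p)%N -> (r <= k)%N -> r%:R * b k <= k%:R * b r.
  elim: k => [|k IH] kp; first by rewrite leqn0 => /eqP->.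
  rewrite leq_eqVlt => /orP[/eqP->//|]; rewrite ltnS => rk.
  have k0 : (0 : R) < k%:R by rewrite ltr0n (leq_trans r0).
  have h1 := IH (ltnW kp) rk; have h2 := slope k kp.
  have r0R : (0 : R) <= r%:R by rewrite ler0n.
  rewrite -(ler_pM2l k0) mulrCA (le_trans (ler_wpM2l r0R h2)) //.
  by rewrite mulrCA [leRHS]mulrCA ler_wpM2l.
have bp : b p = 1.
  rewrite /b -[RHS](sin_pihalf R); congr sin; field.
  by rewrite gt_eqF.
by rewrite bE ler_pdivrMr // mulrC; have := main p (leqnn p) rp; rewrite bp mulr1.
Qed.

Definition grid_angle (R : realType) (n a : nat) : R := pi * (a%:R / 2 ^+ n).

(** At a zero of the sine this is 0, because 1 / 0 = 0 and ln 0 = 0. *)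
Definition log_sin (R : realType) (x : R) : R := ln (1 / sin x ^+ 2).

(** Only sin^2 and cosines of even multiples of the angle matter later; they
are even and have period pi, which brings the angle into (0, pi / 2]. *)
Lemma grid_reduce (R : realType) (n a : nat) : ~~ (2 ^ n %| a)%N ->
  let r := minn (a %% 2 ^ n) (2 ^ n - a %% 2 ^ n) in
  [/\ (0 < r)%N, (r <= (2 ^ n)./2)%N,
     `|sin (grid_angle R n a)| = `|sin (grid_angle R n r)| &
     forall l : nat, cos (l%:R * (2 * grid_angle R n a)) =
                     cos (l%:R * (2 * grid_angle R n r))].
Proof.
move=> na; set M := (2 ^ n)%N; set s := (a %% M)%N => r.
have M0 : (0 < M)%N by rewrite expn_gt0.
have s0 : (0 < s)%N by rewrite lt0n.
have sM : (s < M)%N by rewrite ltn_mod.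
have MR : (2 ^+ n : R) = M%:R by rewrite natrX.
have M0R : (M%:R : R) != 0 by rewrite pnatr_eq0 -lt0n.
have E1 : grid_angle R n a = grid_angle R n s + pi *+ (a %/ M)%N.
  rewrite /grid_angle MR {1}(divn_eq a M) -/s natrD natrM.
  by rewrite -(mulr_natl pi); field.
have sa : `|sin (grid_angle R n a)| = `|sin (grid_angle R n s)|.
  by rewrite E1 (alternatingn (@sinDpi R)) normrM normrX normrN1 expr1n mul1r.
have ca l : cos (l%:R * (2 * grid_angle R n a)) =
            cos (l%:R * (2 * grid_angle R n s)).
  rewrite E1 (_ : _ * _ = l%:R * (2 * grid_angle R n s) + pi *+ 2 *+ (l * (a %/ M))).
    by rewrite (periodicn (@cosD2pi R)).
  by rewrite mulnC mulrnA -(mulr_natl (pi *+ 2 *+ (a %/ M)) l) -(mulr_natl (pi *+ 2))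
    -(mulr_natl pi (a %/ M)); ring.
have E2 : grid_angle R n (M - s) = pi - grid_angle R n s.
  by rewrite /grid_angle MR natrB ?(ltnW sM) //; field.
have ss : `|sin (grid_angle R n (M - s))| = `|sin (grid_angle R n s)|.
  by rewrite E2 sinB sinpi cospi mul0r sub0r mulN1r opprK.
have cs l : cos (l%:R * (2 * grid_angle R n (M - s))) =
            cos (l%:R * (2 * grid_angle R n s)).
  rewrite E2 (_ : _ * _ = - (l%:R * (2 * grid_angle R n s)) + pi *+ 2 *+ l).
    by rewrite (periodicn (@cosD2pi R)) cosN.
  by rewrite -(mulr_natl (pi *+ 2) l); ring.
rewrite /r; split.
- by rewrite leq_min s0 subn_gt0.
- by rewrite geq_min !geq_half_double; lia.
- by rewrite sa /minn; case: ifP.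
- by move=> l; rewrite ca /minn; case: ifP.
Qed.

Lemma log_sinE (R : realType) (x : R) : sin x != 0 ->
  log_sin x = - (2 * ln `|sin x|).
Proof.
move=> sx; rewrite /log_sin div1r lnV ?posrE ?exprn_even_gt0 //.
by rewrite -real_normK ?num_real // lnXn ?normr_gt0 // mulr_natl.
Qed.

Lemma log_sin_ge0 (R : realType) (x : R) : 0 <= log_sin x.
Proof.
have [s0|s0] := eqVneq (sin x) 0.
  by rewrite /log_sin s0 expr0n /= invr0 mulr0 ln0.
rewrite log_sinE // oppr_ge0 pmulr_rle0 // ln_le0 //.
exact: sin_max.
Qed.

Lemma sin_double_neq0 (R : realType) (x : R) :
  sin (2 * x) != 0 -> (sin x != 0) && (cos x != 0).
Proof.
by rewrite mulr_natl sin_mulr2n -mulr_natl !mulf_eq0 !negb_or => /and3P[_ -> ->].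
Qed.

(** The doubling formula sin (2 x) = 2 sin x cos x.  The angles x and x + pi / 2
are the two candidates that arise from one more binary digit. *)
Lemma log_sin_double (R : realType) (x : R) : sin (2 * x) != 0 ->
  log_sin x + log_sin (x + pi / 2) = ln 4 + log_sin (2 * x).
Proof.
move=> s2; have /andP[sx cx] := sin_double_neq0 s2.
have sc : sin (x + pi / 2) != 0 by rewrite sinDpihalf.
rewrite !log_sinE // sinDpihalf (mulr_natl x) sin_mulr2n -(mulr_natl (_ * _)) !normrM.
rewrite normr_nat !lnM ?posrE ?mulr_gt0 ?normr_gt0 //.
have -> : (4 : R) = 2 ^+ 2 by rewrite -natrX.
by rewrite lnXn //; ring.
Qed.

Lemma pow2_double (n : nat) (a : nat) : ~~ (2 ^ n %| a)%N ->
  (2 ^ n = (2 ^ n)./2.*2)%N.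
Proof. by case: n => [|n _]; rewrite ?expn0 ?dvd1n // expnS mul2n doubleK. Qed.

Lemma sin_grid_ge_abs (R : realType) (n a : nat) : ~~ (2 ^ n %| a)%N ->
  (minn (a %% 2 ^ n) (2 ^ n - a %% 2 ^ n))%:R / (2 ^ n)./2%:R
  <= `|sin (grid_angle R n a)|.
Proof.
move=> na; have [r0 rp -> _] := grid_reduce R na.
rewrite (le_trans _ (ler_norm _)) // /grid_angle -natrX.
move: r0 rp; set r := minn _ _ => r0 rp.
by have := @sin_grid_ge R _ r; rewrite {2}(pow2_double na); apply; rewrite r0.
Qed.

Lemma sin_grid_ge_inv (R : realType) (n a : nat) : ~~ (2 ^ n %| a)%N ->
  (2 ^ n)%:R^-1 <= `|sin (grid_angle R n a)|.
Proof.
move=> na; apply: le_trans (sin_grid_ge_abs R na).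
have [r0 rp _ _] := grid_reduce R na.
have p0 : (0 < (2 ^ n)./2)%N by rewrite (leq_trans r0 rp).
rewrite (@le_trans _ _ ((2 ^ n)./2%:R^-1)) //.
  rewrite lef_pV2 ?posrE ?ltr0n ?expn_gt0 // ler_nat {2}(pow2_double na).
  by rewrite -addnn leq_addr.
by rewrite ler_peMl ?invr_ge0 // ler1n.
Qed.

Lemma sin_grid_neq0 (R : realType) (n a : nat) : ~~ (2 ^ n %| a)%N ->
  sin (grid_angle R n a) != 0.
Proof.
move=> na; rewrite -normr_gt0 (lt_le_trans _ (sin_grid_ge_inv R na)) //.
Qed.

Lemma log_sin_grid_le (R : realType) (n a : nat) : ~~ (2 ^ n %| a)%N ->
  log_sin (grid_angle R n a) <= 2 * ln 2 * n%:R.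
Proof.
move=> na; rewrite log_sinE ?sin_grid_neq0 //.
have h : ln (2 ^ n)%:R^-1 <= ln `|sin (grid_angle R n a)|.
  by rewrite ler_ln ?posrE ?normr_gt0 ?sin_grid_neq0 ?sin_grid_ge_inv.
move: h; rewrite lnV ?posrE // natrX lnXn // -(mulr_natr (ln 2)).
lra.
Qed.

(** The sum of the two reciprocals stands for the reciprocal of the smaller
argument: summed over the residues, each of them gives a harmonic sum. *)
Lemma inv_sin_grid_le (R : realType) (n a : nat) : ~~ (2 ^ n %| a)%N ->
  `|sin (grid_angle R n a)|^-1 <=
  (2 ^ n)%:R / 2 * ((a %% 2 ^ n)%:R^-1 + (2 ^ n - a %% 2 ^ n)%:R^-1).
Proof.
move=> na; have [r0 rp _ _] := grid_reduce R na.
have := sin_grid_ge_abs R na.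
move: r0 rp; set r := minn _ _ => r0 rp h.
have p0 : (0 < (2 ^ n)./2)%N by rewrite (leq_trans r0 rp).
have s0 : (0 : R) < r%:R / (2 ^ n)./2%:R by rewrite divr_gt0 ?ltr0n.
rewrite (@le_trans _ _ ((2 ^ n)./2%:R * r%:R^-1)) //.
  by rewrite -[leRHS]invrK invfM invrK mulrC lef_pV2 ?posrE // (lt_le_trans s0 h).
rewrite (_ : (2 ^ n)%:R / 2 = (2 ^ n)./2%:R :> R); last first.
  by rewrite {1}(pow2_double na) -mul2n natrM mulrAC mulfV ?mul1r.
rewrite ler_pM2l ?ltr0n // /r /minn; case: ifP => _.
  by rewrite lerDl invr_ge0.
by rewrite lerDr invr_ge0.
Qed.

Lemma ln4E (R : realType) : ln 4 = 2 * ln 2 :> R.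
Proof.
have -> : (4 : R) = 2 ^+ 2 by rewrite -natrX.
by rewrite lnXn // mulr_natl.
Qed.

(** The constant ln 4 compensates for the factor 2 in - 2 ln (2 |sin|). *)
Lemma log_sin_trunc_error (R : realType) (n a : nat) : ~~ (2 ^ n %| a)%N ->
  `|2 * cos_sum (2 ^ n) (grid_angle R n a) + ln 4 - log_sin (grid_angle R n a)|
  <= 4 / (2 ^ n)%:R * `|sin (grid_angle R n a)|^-1.
Proof.
move=> na; rewrite log_sinE ?sin_grid_neq0 // ln4E.
have [r0 rp -> cE] := grid_reduce R na.
have -> : cos_sum (2 ^ n) (grid_angle R n a) = cos_sum (2 ^ n) (grid_angle R n
   (minn (a %% 2 ^ n) (2 ^ n - a %% 2 ^ n))).
  by apply: eq_bigr => l _; rewrite cE.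
move: r0 rp; set r := minn _ _ => r0 rp.
have := @cos_sum_ln_sin_error R (2 ^ n)./2 r; rewrite r0 rp => /(_ isT).
rewrite -(pow2_double na) natrX -/(grid_angle R n r) => -[s0 h].
rewrite -natrX (gtr0_norm s0).
rewrite (_ : _ - _ = 2 * (cos_sum (2 ^ n) (grid_angle R n r) +
  ln (sin (grid_angle R n r)) + ln 2)); last by ring.
rewrite normrM ger0_norm // -mulrA -invfM natrX.
by have -> : 4 = 2 * 2 :> R; [rewrite -natrM | rewrite -mulrA ler_pM2l].
Qed.

Lemma cos_sum_le (R : realType) (n : nat) (x : R) :
  `|cos_sum (2 ^ n) x| <= n%:R.
Proof.
apply: le_trans (harmonic_pow2 R n); apply: le_trans (ler_norm_sum _ _ _) _.
apply: ler_sum => l _; rewrite normrM normfV normr_nat.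
by rewrite ler_piMl ?invr_ge0 // cos_max.
Qed.

(** * Sums over residues and over subsets *)

Lemma sum_nat_double (V : nmodType) (K : nat) (f : nat -> V) :
  \sum_(0 <= k < K.*2) f k = \sum_(0 <= k < K) (f k.*2 + f k.*2.+1).
Proof.
elim: K => [|K IH]; first by rewrite !big_geq.
by rewrite doubleS !big_nat_recr //= IH addrA.
Qed.

(** The left-hand side skips the multiples of B, which are even. *)
Lemma sum_odd_blocks (V : nmodType) (A B : nat) (f : nat -> V) : ~~ odd B ->
  \sum_(0 <= l < A) \sum_(l * B + 1 <= k < l.+1 * B | odd k) f k =
  \sum_(0 <= k < A * B | odd k) f k.
Proof.
move=> oB; elim: A => [|A IH]; first by rewrite mul0n !big_geq.
rewrite big_nat_recr //= IH.
rewrite [in RHS](big_cat_nat (n := (A * B)%N)) //=; last by rewrite leq_mul2r leqnSn orbT.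
congr (_ + _); case: B oB {IH} => [|B] oB; first by rewrite !muln0 !big_geq.
rewrite addn1 [in RHS]big_ltn_cond; last by rewrite ltn_mul2r ltnSn.
by rewrite oddM (negbTE oB) andbF.
Qed.

(** Every k that 2^n does not divide is k' 2^(n-t) for a unique odd k' and a
unique t with 1 <= t <= n. *)
Lemma sum_by_odd_part (V : nmodType) (n w : nat) (g : nat -> V) :
  \sum_(1 <= t < n.+1) \sum_(0 <= k < 2 ^ (t + w) | odd k) g (k * 2 ^ (n - t))%N =
  \sum_(0 <= k < 2 ^ (n + w) | ~~ (2 ^ n %| k)%N) g k.
Proof.
elim: n g => [|n IH] g; first by rewrite big_geq // big1 // => k; rewrite dvd1n.
rewrite big_nat_recr //= subnn.
transitivity (\sum_(1 <= t < n.+1) \sum_(0 <= k < 2 ^ (t + w) | odd k)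
    g (k * 2 ^ (n - t)).*2 + \sum_(0 <= k < 2 ^ (n + w)) g k.*2.+1).
  congr (_ + _).
    apply: eq_big_nat => t /andP[_ tn]; apply: eq_bigr => k _.
    by rewrite subSn // expnS mulnCA mul2n.
  rewrite addSn expnS mul2n big_mkcond sum_nat_double /=.
  by apply: eq_bigr => k _; rewrite odd_double /= add0r expn0 muln1.
rewrite (IH (fun k => g k.*2)) addSn expnS mul2n [RHS]big_mkcond sum_nat_double.
rewrite [X in X + _ = _]big_mkcond -big_split; apply: eq_bigr => k _ /=.
rewrite -mul2n expnS dvdn_pmul2l //; congr (_ + _).
rewrite (_ : (2 * 2 ^ n %| (2 * k).+1)%N = false) //.
apply/negP => /(dvdn_trans (dvdn_mulr _ (dvdnn 2))).
by rewrite dvdn2 /= mul2n odd_double.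
Qed.

(** Expand the product over j of F j + G j, where F j is x j for j <= s and 0
beyond, and G j is 0 for j = s and 1 otherwise: a subset survives exactly if it
contains s and nothing larger. *)
Lemma big_set_max (R : comNzRingType) (D s : nat) (x : nat -> R) : (s < D)%N ->
  \sum_(u : {set 'I_D} | (\max_(j in u) j.+1)%N == s.+1) \prod_(j in u) x j =
  x s * \prod_(0 <= j < s) (1 + x j).
Proof.
move=> sD; pose so := Ordinal sD.
pose F (j : 'I_D) := if (j <= s)%N then x j else 0.
pose G (j : 'I_D) : R := (j != so)%:R.
transitivity (\prod_(j < D) (F j + G j)).
  rewrite bigA_distr.
  rewrite [RHS](bigID (fun u : {set 'I_D} => (\max_(j in u) j.+1)%N == s.+1)) /=.
  rewrite [X in _ = _ + X]big1 ?addr0 => [|u us]; last first.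
    have [sou|sou] := boolP (so \in u); last first.
      by rewrite (bigD1 so) //= (negbTE sou) /G eqxx mul0r.
    have [j ju] : exists2 j, j \in u & (s < j)%N.
      apply/exists_inP; apply: contraR us => /exists_inPn h.
      rewrite eqn_leq (leq_bigmax_cond (F := fun j : 'I_D => j.+1) _ sou) andbT.
      by apply/bigmax_leqP => j /h; rewrite -leqNgt ltnS.
    by move=> sj; rewrite (bigD1 j) //= ju /F leqNgt sj mul0r.
  apply: eq_big => u; first by [].
  move=> /eqP us.
  have le j : j \in u -> (j <= s)%N.
    by move=> ju; rewrite -ltnS -us (leq_bigmax_cond (F := fun j : 'I_D => j.+1)).
  have sou : so \in u.
    have u0 : (0 < #|u|)%N.
      rewrite lt0n; apply/negP => /eqP/cards0_eq u0.
      by move: us; rewrite u0 big_set0.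
    have [j ju jE] := eq_bigmax_cond (fun j : 'I_D => j.+1) u0.
    by move: us; rewrite jE => -[js]; rewrite (_ : so = j) //; apply: val_inj.
  rewrite [LHS]big_mkcond; apply: eq_bigr => j _; case: ifP => ju.
    by rewrite /F le.
  by rewrite /G; case: eqP ju => // ->; rewrite sou.
rewrite (bigD1 so) //= /F /G leqnn eqxx addr0; congr (_ * _).
rewrite (eq_bigr (fun j : 'I_D => if (j < s)%N then 1 + x j else 1)); last first.
  move=> j; rewrite -val_eqE /= => /[dup] js ->; rewrite leq_eqVlt (negbTE js) /=.
  by case: ifP; rewrite ?add0r // addrC.
rewrite -big_mkcondr big_mkord.
rewrite (big_ord_widen_cond _ predT (fun j => 1 + x j) (ltnW sD)) /=.
by apply: eq_bigl => j; rewrite andbC -val_eqE /=; case: ltngtP.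
Qed.

Lemma big_set_ord_max (R : comNzRingType) (s : nat) (x : nat -> R) (c : R) :
  \sum_(u : {set 'I_s.+1} | ord_max \in u)
     ((\prod_(j in u | j != ord_max) x j) * c) = (\prod_(0 <= j < s) (1 + x j)) * c.
Proof.
rewrite -mulr_suml; congr (_ * _).
pose F (j : 'I_s.+1) := if j == ord_max then 1 else x j.
pose G (j : 'I_s.+1) : R := (j != ord_max)%:R.
transitivity (\prod_(j < s.+1) (F j + G j)).
  rewrite bigA_distr [RHS](bigID (fun u : {set 'I_s.+1} => ord_max \in u)) /=.
  rewrite [X in _ = _ + X]big1 ?addr0 => [|u /negbTE us]; last first.
    by rewrite (bigD1 ord_max) //= us /G eqxx mul0r.
  apply: eq_big => u; first by [].
  move=> us; rewrite [LHS]big_mkcond; apply: eq_bigr => j _ /=.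
  rewrite /F /G; case: (eqVneq j ord_max) => [->|_]; first by rewrite us.
  by rewrite andbT.
rewrite big_ord_recr /= /F /G eqxx addr0 mulr1 big_mkord.
apply: eq_bigr => j _.
have /negbTE -> : widen_ord (leqnSn s) j != ord_max.
  by rewrite -val_eqE /= ltn_eqF.
exact: addrC.
Qed.

(** * Choosing the digits of one component *)

Lemma grid_angle_double (R : realType) (n a : nat) :
  2 * grid_angle R n.+1 a = grid_angle R n a.
Proof. by rewrite /grid_angle exprS; field; rewrite expf_neq0. Qed.

Lemma grid_angle_mul (R : realType) (n t a : nat) : (t <= n)%N ->
  grid_angle R n (a * 2 ^ (n - t)) = grid_angle R t a.
Proof.
move=> tn; rewrite /grid_angle natrM natrX -{2}(subnK tn) exprD.
by field; rewrite !expf_neq0.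
Qed.

Lemma log_sin_grid_mod (R : realType) (n a b : nat) : a = b %[mod 2 ^ n] ->
  log_sin (grid_angle R n a) = log_sin (grid_angle R n b).
Proof.
have E c : log_sin (grid_angle R n c) = log_sin (grid_angle R n (c %% 2 ^ n)).
  rewrite /log_sin {1}(divn_eq c (2 ^ n)).
  have -> : grid_angle R n (c %/ 2 ^ n * 2 ^ n + c %% 2 ^ n) =
      grid_angle R n (c %% 2 ^ n) + pi *+ (c %/ 2 ^ n).
    rewrite /grid_angle natrD natrM natrX -(mulr_natl pi); field.
    by rewrite expf_neq0.
  by rewrite (alternatingn (@sinDpi R)) exprMn -exprM mulnC exprM sqrrN !expr1n (mul1r (_ ^+ 2)).
by move=> ab; rewrite E ab -E.
Qed.

(** Since a is odd, the two candidates give angles that differ by pi / 2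
modulo pi. *)
Lemma log_sin_grid_digit (R : realType) (n a x : nat) : odd a -> odd x ->
  log_sin (grid_angle R n.+2 (a * x)) +
  log_sin (grid_angle R n.+2 (a * (x + 2 ^ n.+1))) =
  ln 4 + log_sin (grid_angle R n.+1 (a * x)).
Proof.
move=> oa ox; rewrite -(grid_angle_double R n.+1) -log_sin_double; last first.
  rewrite grid_angle_double sin_grid_neq0 //.
  apply/negP => /(dvdn_trans (dvdn_exp2l 2 (ltn0Sn n))).
  by rewrite expn1 dvdn2 oddM oa ox.
congr (_ + _); have [h aE] : exists h, a = (1 + 2 * h)%N.
  by exists a./2; rewrite -{1}(odd_double_half a) oa mul2n.
have -> : (a * (x + 2 ^ n.+1) = h * 2 ^ n.+2 + (a * x + 2 ^ n.+1))%N.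
  by rewrite aE [(2 ^ n.+2)%N]expnS; ring.
rewrite (@log_sin_grid_mod R n.+2 _ (a * x + 2 ^ n.+1)); last by rewrite modnMDl.
congr log_sin; rewrite /grid_angle natrD natrX !exprS; field.
by rewrite expf_neq0.
Qed.

Lemma log_sin_half (R : realType) (a : nat) : odd a ->
  log_sin (grid_angle R 1 a) = 0.
Proof.
move=> oa; rewrite (@log_sin_grid_mod R 1 a 1); last by rewrite expn1 !modn2 oa.
rewrite /log_sin /grid_angle (_ : pi * (1%:R / 2 ^+ 1) = pi / 2); last by field.
by rewrite sin_pihalf expr1n divr1 ln1.
Qed.

(** This serves the first component, which is 1 without any minimization.
Pairing k with k + 2^n reduces the sum at level n + 1 to the one at level n. *)
Lemma sum_log_sin_grid (R : realType) (n : nat) :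
  \sum_(1 <= k < 2 ^ n) log_sin (grid_angle R n k) <= (2 ^ n - 1)%:R * ln 4.
Proof.
have l4 : 0 <= ln 4 :> R by rewrite ln_ge0 // ler1n.
elim: n => [|n IH]; first by rewrite big_geq // mul0r.
have n0 : (0 < 2 ^ n)%N by rewrite expn_gt0.
rewrite (big_cat_nat (n := (2 ^ n)%N)) ?leq_exp2l //=.
rewrite [X in _ + X <= _]big_ltn ?ltn_exp2l //.
have -> : log_sin (grid_angle R n.+1 (2 ^ n)) = 0.
  have := @grid_angle_mul R n.+1 1 1 isT; rewrite mul1n subSS subn0 => ->.
  exact: log_sin_half.
rewrite add0r (_ : \sum_((2 ^ n).+1 <= k < 2 ^ n.+1) _ =
   \sum_(1 <= k < 2 ^ n) log_sin (grid_angle R n.+1 (k + 2 ^ n))); last first.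
  by rewrite -[(2 ^ n).+1]add1n big_addn expnS mul2n -addnn addnK.
rewrite -big_split /= (_ : \sum_(1 <= k < 2 ^ n) _ =
   \sum_(1 <= k < 2 ^ n) (ln 4 + log_sin (grid_angle R n k))); last first.
  apply: eq_big_nat => k /andP[k0 kn].
  rewrite -(grid_angle_double R n) -log_sin_double ?grid_angle_double; last first.
    by rewrite sin_grid_neq0 // gtnNdvd.
  congr (_ + log_sin _); rewrite /grid_angle natrD natrX exprS; field.
  by rewrite expf_neq0.
rewrite big_split /= sumr_const_nat -(mulr_natl (ln 4)).
have -> : ((2 ^ n.+1 - 1)%:R : R) = (2 ^ n - 1)%:R + (2 ^ n - 1)%:R + 1.
  by rewrite expnS mul2n -addnn -!natrD natr1; congr _%:R; lia.
by move: IH; rewrite !mulrDl; lra.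
Qed.

Lemma halving_sum_recl (R : realType) (v n : nat) (f : nat -> R) : (v <= n)%N ->
  \sum_(v <= t < n.+1) (1 / 2 ^+ (t - v) * f t) =
  f v + 1 / 2 * \sum_(v.+1 <= t < n.+1) (1 / 2 ^+ (t - v.+1) * f t).
Proof.
move=> vn; rewrite big_ltn ?ltnS // subnn expr0 divr1 mul1r mulr_sumr.
congr (_ + _); apply: eq_big_nat => t /andP[vt _].
by rewrite mulrA !div1r -invfM -exprS -subSn // subSS.
Qed.

(** Halving the weights 1 / 2^(t-v) of stage v gives those of stage v - 1, so
each step bounds a weighted sum by the previous one without its first term,
which is the diagonal entry C (v-1) (v-1).  The induction therefore bounds the
diagonal entries below v plus the weighted sum of the C t v by c times the
corresponding expression in B. *)
Lemma digit_potential (R : realType) (n : nat) (c : R) (B : nat -> R)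
    (C : nat -> nat -> R) : (0 < n)%N -> 0 <= c ->
  (forall t, 0 <= B t) -> (forall t, (1 <= t <= n)%N -> C t 1%N = 0) ->
  (forall v, (1 <= v < n)%N ->
     \sum_(v.+1 <= t < n.+1) (1 / 2 ^+ (t - v.+1) * C t v.+1) <=
     1 / 2 * \sum_(v.+1 <= t < n.+1) (1 / 2 ^+ (t - v.+1) * (c * B t + C t v))) ->
  \sum_(1 <= v < n.+1) C v v <= c * \sum_(1 <= v < n.+1) B v.
Proof.
move=> n0 c0 B0 C1 step.
pose S v := \sum_(v <= t < n.+1) (1 / 2 ^+ (t - v) * C t v).
pose T v := \sum_(v <= t < n.+1) (1 / 2 ^+ (t - v) * B t).
have main v : (1 <= v <= n)%N ->
    \sum_(1 <= u < v) C u u + S v <= c * (\sum_(1 <= u < v) B u + T v).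
  elim: v => [//|[|v] IH] /andP[_ vn].
    rewrite !big_geq // !add0r /S big_nat_cond big1 => [|t]; last first.
      by rewrite andbT ltnS => h; rewrite C1 // mulr0.
    apply: mulr_ge0 => //; apply: sumr_ge0 => t _.
    by rewrite mulr_ge0 ?divr_ge0 ?exprn_ge0.
  have {}IH := IH (ltnW vn).
  rewrite !(big_nat_recr v.+1) //=.
  have := step v.+1 vn.
  move: IH; rewrite /S /T !(halving_sum_recl _ (ltnW vn)).
  have -> : \sum_(v.+2 <= t < n.+1) 1 / 2 ^+ (t - v.+2) * (c * B t + C t v.+1) =
     c * \sum_(v.+2 <= t < n.+1) 1 / 2 ^+ (t - v.+2) * B t +
     \sum_(v.+2 <= t < n.+1) 1 / 2 ^+ (t - v.+2) * C t v.+1.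
    rewrite mulr_sumr -big_split; apply: eq_bigr => t _ /=; ring.
  rewrite !mulrDr; lra.
have := main n; rewrite n0 leqnn => /(_ isT).
by rewrite /S /T !big_nat1 subnn expr0 divr1 !mul1r -!big_nat_recr.
Qed.

Definition comp_log (R : realType) (m : nat) (w z : nat -> nat) (j k : nat) : R :=
  log_sin (grid_angle R (m - w j) (k * z j)).

Definition prefix_prod (R : realType) (m : nat) (gamma : nat -> R)
    (w z : nat -> nat) (s k : nat) : R :=
  \prod_(0 <= j < s) (1 + gamma j * comp_log R m w z j k).

Lemma prefix_prod_ge0 (R : realType) (m : nat) (gamma : nat -> R)
    (w z : nat -> nat) (s k : nat) : (forall j, 0 < gamma j) ->
  0 <= prefix_prod m gamma w z s k.
Proof.
move=> g0; apply: prodr_ge0 => j _.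
by rewrite addr_ge0 // mulr_ge0 ?log_sin_ge0 // ltW.
Qed.

(** The angles in h are those of the residues k 2^(m - w_s - t) modulo 2^m, and
the sum over u is the expansion of a product. *)
Lemma quality_hE (R : realType) (m : nat) (gamma : nat -> R)
    (w z : nat -> nat) (s v x : nat) : (0 < v)%N ->
  quality_h m gamma w z s v x =
  \sum_(v <= t < (m - w s).+1) (1 / 2 ^+ (t - v) *
    \sum_(0 <= k < 2 ^ (t + w s) | odd k)
      prefix_prod m gamma w z s (k * 2 ^ (m - w s - t)) *
      (1 + gamma s * log_sin (grid_angle R v (k * x)))).
Proof.
move=> v0; apply: eq_big_nat => t /andP[vt]; rewrite ltnS => tn.
congr (_ * _); rewrite sum_odd_blocks; last first.
  by rewrite oddX /= orbF -lt0n (leq_trans v0 vt).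
rewrite addnC expnD; apply: eq_bigr => k _.
rewrite /prefix_prod -(@big_set_ord_max R s (fun j => gamma j * comp_log R m w z j _)).
apply: eq_bigr => u us; congr (_ * _); last first.
  rewrite /log_sin /grid_angle natrM; congr (_ + _ * ln (_ / sin _ ^+ _)).
  by field; rewrite expf_neq0.
rewrite big_split /= /prod_weight; congr (_ * _).
  by apply: eq_bigl => j; rewrite !inE andbC.
apply: eq_bigr => j _; rewrite /comp_log /log_sin; congr (ln (_ / sin _ ^+ _)).
rewrite /grid_angle !natrM natrX -{1}(subnK tn) exprD.
by field; rewrite !expf_neq0.
Qed.

Lemma dbd_run_odd (R : realType) (m : nat) (gamma : nat -> R)
    (w z : nat -> nat) (s : nat) (zs : nat -> nat) :
  dbd_run m gamma w z s zs -> forall v, (1 <= v <= m - w s)%N -> odd (zs v).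
Proof.
case=> z1 step; elim=> [//|[|v] IH] /andP[_ vn]; first by rewrite z1.
have [b [_ ->]] := step v.+2 vn.
rewrite oddD oddM oddX /= andbF addbF; apply: IH; exact: ltnW.
Qed.

Lemma dbd_run_mod (R : realType) (m : nat) (gamma : nat -> R)
    (w z : nat -> nat) (s : nat) (zs : nat -> nat) :
  dbd_run m gamma w z s zs -> forall v n, (1 <= v <= n)%N -> (n <= m - w s)%N ->
  zs n = zs v %[mod 2 ^ v].
Proof.
case=> z1 step v n /andP[v0]; elim: n => [|n IH]; first by case: v v0.
rewrite leq_eqVlt => /orP[/eqP-> //|]; rewrite ltnS => vn nm.
have n1 : (2 <= n.+1 <= m - w s)%N by rewrite nm ltnS (leq_trans v0 vn).
have [b [_ ->]] := step _ n1; rewrite -(IH vn (ltnW nm)) /=.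
have -> : (2 ^ n = 2 ^ (n - v) * 2 ^ v)%N by rewrite -expnD subnK.
by rewrite mulnA addnC modnMDl.
Qed.

(** A minimum over the two digits is at most their mean, which the doubling
identity evaluates. *)
Lemma dbd_step (R : realType) (m : nat) (gamma : nat -> R)
    (w z : nat -> nat) (s : nat) (zs : nat -> nat) :
  (forall j, 0 < gamma j) -> dbd_run m gamma w z s zs ->
  let W t k := prefix_prod m gamma w z s (k * 2 ^ (m - w s - t)) in
  let B t := \sum_(0 <= k < 2 ^ (t + w s) | odd k) W t k in
  let C t v := \sum_(0 <= k < 2 ^ (t + w s) | odd k)
      W t k * log_sin (grid_angle R v (k * zs v)) in
  forall v, (1 <= v < m - w s)%N ->
     \sum_(v.+1 <= t < (m - w s).+1) (1 / 2 ^+ (t - v.+1) * C t v.+1) <=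
     1 / 2 * \sum_(v.+1 <= t < (m - w s).+1)
        (1 / 2 ^+ (t - v.+1) * (ln 4 * B t + C t v)).
Proof.
move=> g0 run W B C [//|v] /andP[_ vn].
have [_ /(_ v.+2 vn)[b [bmin zE]]] := run.
have oz := dbd_run_odd run (v := v.+1) (ltnW vn).
pose D t x := \sum_(0 <= k < 2 ^ (t + w s) | odd k)
      W t k * log_sin (grid_angle R v.+2 (k * x)).
have hE x : quality_h m gamma w z s v.+2 x =
    \sum_(v.+2 <= t < (m - w s).+1) (1 / 2 ^+ (t - v.+2) * B t) +
    gamma s * \sum_(v.+2 <= t < (m - w s).+1) (1 / 2 ^+ (t - v.+2) * D t x).
  rewrite quality_hE // mulr_sumr -big_split; apply: eq_bigr => t _ /=.
  rewrite [gamma s * _]mulrCA -mulrDr; congr (_ * _).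
  rewrite mulr_sumr -big_split; apply: eq_bigr => k _ /=; rewrite -/(W t k); ring.
have sumD t : D t (zs v.+1) + D t (zs v.+1 + 2 ^ v.+1)%N = ln 4 * B t + C t v.+1.
  rewrite -big_split mulr_sumr -big_split; apply: eq_bigr => k ok /=.
  by rewrite -mulrDr log_sin_grid_digit // mulrDr mulrC.
have -> : \sum_(v.+2 <= t < (m - w s).+1) 1 / 2 ^+ (t - v.+2) * (ln 4 * B t + C t v.+1) =
  \sum_(v.+2 <= t < (m - w s).+1) (1 / 2 ^+ (t - v.+2) * D t (zs v.+1)) +
  \sum_(v.+2 <= t < (m - w s).+1) (1 / 2 ^+ (t - v.+2) * D t (zs v.+1 + 2 ^ v.+1)%N).
  by rewrite -big_split; apply: eq_bigr => t _; rewrite -sumD /= mulrDr.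
have := bmin false; have := bmin true.
rewrite -zE /= mul0n mul1n addn0 !hE !lerD2l !ler_pM2l //.
rewrite -[\sum_(_ <= t < _) (_ * C t v.+2)]/(\sum_(v.+2 <= t < (m - w s).+1)
  (1 / 2 ^+ (t - v.+2) * D t (zs v.+2))).
lra.
Qed.

(** The residues that 2^(m - w_s) does not divide are classified by t; the
log-sine at such a residue depends on z_s modulo 2^t only, that is, on the
digits fixed up to stage t, and so it is a diagonal entry of
[digit_potential]. *)
Lemma dbd_component_bound (R : realType) (m : nat) (gamma : nat -> R)
    (w z : nat -> nat) (s : nat) (zs : nat -> nat) :
  (forall j, 0 < gamma j) -> (w s < m)%N -> dbd_run m gamma w z s zs ->
  z s = zs (m - w s)%N ->
  \sum_(0 <= k < 2 ^ m | ~~ (2 ^ (m - w s) %| k)%N)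
     prefix_prod m gamma w z s k * comp_log R m w z s k <=
  ln 4 * \sum_(0 <= k < 2 ^ m | ~~ (2 ^ (m - w s) %| k)%N)
     prefix_prod m gamma w z s k.
Proof.
move=> g0 wm run zE; set n := (m - w s)%N.
have n0 : (0 < n)%N by rewrite subn_gt0.
have -> : (2 ^ m = 2 ^ (n + w s))%N by rewrite subnK // ltnW.
rewrite -!sum_by_odd_part.
have W0 t k : 0 <= prefix_prod m gamma w z s (k * 2 ^ (n - t)).
  exact: prefix_prod_ge0.
rewrite (eq_big_nat _ _ (F2 := fun t => \sum_(0 <= k < 2 ^ (t + w s) | odd k)
   prefix_prod m gamma w z s (k * 2 ^ (n - t)) *
   log_sin (grid_angle R t (k * zs t)))); last first.
  move=> t /andP[t0 tn]; apply: eq_bigr => k _; congr (_ * _).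
  rewrite /comp_log -/n mulnAC grid_angle_mul //.
  apply: log_sin_grid_mod; rewrite -modnMmr zE -/n.
  by rewrite (dbd_run_mod run (v := t) (n := n)) ?modnMmr // t0.
apply: (digit_potential (B := fun t => \sum_(0 <= k < 2 ^ (t + w s) | odd k)
   prefix_prod m gamma w z s (k * 2 ^ (n - t))) (C := fun t v =>
   \sum_(0 <= k < 2 ^ (t + w s) | odd k)
   prefix_prod m gamma w z s (k * 2 ^ (n - t)) *
   log_sin (grid_angle R v (k * zs v)))) => //.
- by rewrite ln_ge0 // ler1n.
- by move=> t; apply: sumr_ge0.
- move=> t _; rewrite big1 // => k ok; rewrite (run.1) muln1.
  by rewrite log_sin_half ?mulr0.
- by move=> v; exact: (dbd_step g0 run).
Qed.

(** * Products of log-sines over all components *)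

Lemma dstar_bound (m d : nat) (w : nat -> nat) (s : nat) :
  (forall j, (w j <= w j.+1)%N) -> (s < dstar m d w)%N ->
  (w s < m)%N && (s < d)%N.
Proof.
move=> wS; rewrite /dstar.
have [->//|[j jm ->]] : \max_(j < d | (w j < m)%N) j.+1 = 0%N \/
    exists2 j : 'I_d, (w j < m)%N & \max_(j < d | (w j < m)%N) j.+1 = j.+1.
  have [/existsP[j jm]|/existsPn no] := boolP [exists j : 'I_d, (w j < m)%N].
    have [|i im iE] := eq_bigmax_cond (A := [pred j : 'I_d | (w j < m)%N])
      (fun j : 'I_d => j.+1).
      by apply/card_gt0P; exists j.
    by right; exists i.
  by left; rewrite big_pred0 // => j; apply/negbTE/no.
rewrite ltnS => sj; rewrite (leq_ltn_trans sj (ltn_ord j)) andbT.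
apply: leq_ltn_trans jm.
exact: (homo_leq leqnn leq_trans).
Qed.

Lemma dstar_full (m d : nat) (w : nat -> nat) (j : nat) :
  (dstar m d w <= j < d)%N -> (m <= w j)%N.
Proof.
case/andP=> Dj jd; rewrite leqNgt; apply/negP => jm.
have := leq_bigmax_cond (F := fun j : 'I_d => j.+1)
  (P := fun j : 'I_d => (w j < m)%N) (Ordinal jd) jm.
by rewrite -/(dstar m d w) => /leq_trans/(_ Dj); rewrite ltnn.
Qed.

Lemma cbc_dbd_odd (R : realType) (d m : nat) (gamma : nat -> R)
    (w z : nat -> nat) (s : nat) :
  (forall j, (w j <= w j.+1)%N) -> reduced_cbc_dbd m d gamma w z ->
  (s < dstar m d w)%N -> odd (z s).
Proof.
move=> wS [z0 _ zr] sD; case: s sD => [|s] sD; first by rewrite z0.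
have [zs [run ->]] := zr s.+1 sD; apply: (dbd_run_odd run).
by have /andP[sm _] := dstar_bound wS sD; rewrite leqnn subn_gt0 sm.
Qed.

Lemma first_component_bound (R : realType) (m : nat) (gamma : nat -> R)
    (w z : nat -> nat) : w 0%N = 0%N -> z 0%N = 1%N ->
  \sum_(0 <= k < 2 ^ m | ~~ (2 ^ (m - w 0) %| k)%N)
     prefix_prod m gamma w z 0 k * comp_log R m w z 0 k <=
  ln 4 * \sum_(0 <= k < 2 ^ m | ~~ (2 ^ (m - w 0) %| k)%N)
     prefix_prod m gamma w z 0 k.
Proof.
move=> w0 z0; rewrite w0 subn0.
have N0 : (0 < 2 ^ m)%N by rewrite expn_gt0.
have E (f : nat -> R) : \sum_(0 <= k < 2 ^ m | ~~ (2 ^ m %| k)%N) f k =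
    \sum_(1 <= k < 2 ^ m) f k.
  rewrite big_ltn_cond // dvdn0 /= big_nat_cond [RHS]big_nat_cond.
  apply: eq_bigl => k; case: (boolP (0 < k < 2 ^ m)%N) => //= /andP[k0 kN].
  by rewrite gtnNdvd.
rewrite !E; apply: le_trans (_ : (2 ^ m - 1)%:R * ln 4 <= _).
  apply: le_trans (sum_log_sin_grid R m); apply: ler_sum => k _.
  by rewrite /prefix_prod big_geq // mul1r /comp_log w0 z0 subn0 muln1.
rewrite mulrC (eq_bigr (fun=> 1)) => [|k _]; last by rewrite /prefix_prod big_geq.
by rewrite sumr_const_nat.
Qed.

Lemma component_bound (R : realType) (d m : nat) (gamma : nat -> R)
    (w z : nat -> nat) (s : nat) :
  w 0%N = 0%N -> (forall j, (w j <= w j.+1)%N) -> (forall j, 0 < gamma j) ->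
  reduced_cbc_dbd m d gamma w z -> (s < dstar m d w)%N ->
  \sum_(0 <= k < 2 ^ m | ~~ (2 ^ (m - w s) %| k)%N)
     prefix_prod m gamma w z s k * comp_log R m w z s k <=
  ln 4 * \sum_(0 <= k < 2 ^ m | ~~ (2 ^ (m - w s) %| k)%N)
     prefix_prod m gamma w z s k.
Proof.
move=> w0 wS g0 [z0 _ zr]; case: s => [|s] sD; first exact: first_component_bound.
have [zs [run zE]] := zr s.+1 sD.
by apply: (dbd_component_bound g0 _ run zE); have /andP[] := dstar_bound wS sD.
Qed.

(** Since w is nondecreasing, fewer residues are admitted for s + 1 than for s,
and all terms are nonnegative.  The admitted sum for s is thus an upper bound,
to which [component_bound] applies. *)
Lemma prefix_sum_bound (R : realType) (d m : nat) (gamma : nat -> R)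
    (w z : nat -> nat) (s : nat) :
  w 0%N = 0%N -> (forall j, (w j <= w j.+1)%N) -> (forall j, 0 < gamma j) ->
  reduced_cbc_dbd m d gamma w z -> (s < dstar m d w)%N ->
  \sum_(0 <= k < 2 ^ m | ~~ (2 ^ (m - w s) %| k)%N)
     prefix_prod m gamma w z s k <=
  (2 ^ m)%:R * \prod_(0 <= j < s) (1 + gamma j * ln 4).
Proof.
move=> w0 wS g0 alg; have P0 s' k : 0 <= prefix_prod m gamma w z s' k.
  exact: prefix_prod_ge0.
have l4 : 0 <= ln 4 :> R by rewrite ln_ge0 // ler1n.
elim: s => [|s IH] sD.
  rewrite [X in _ * X]big_geq // mulr1 -[X in X%:R]subn0 -sumr_const_nat.
  rewrite big_mkcond; apply: ler_sum => k _; rewrite /prefix_prod big_geq //.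
  by case: ifP.
have {}IH := IH (ltnW sD).
apply: le_trans (_ : \sum_(0 <= k < 2 ^ m | ~~ (2 ^ (m - w s) %| k)%N)
     prefix_prod m gamma w z s.+1 k <= _).
  rewrite big_mkcond [leRHS]big_mkcond; apply: ler_sum => k _ /=.
  case: ifP => [|_]; last by case: ifP.
  case: ifP => // /negbFE dv /negP[].
  by apply: dvdn_trans dv; rewrite dvdn_exp2l // leq_sub2l.
rewrite (eq_bigr (fun k => prefix_prod m gamma w z s k +
  gamma s * (prefix_prod m gamma w z s k * comp_log R m w z s k))); last first.
  by move=> k _; rewrite /prefix_prod big_nat_recr //= mulrDr mulr1 mulrCA.
rewrite big_split -mulr_sumr /= big_nat_recr //= mulrA.
apply: le_trans (_ : (\sum_(0 <= k < 2 ^ m | ~~ (2 ^ (m - w s) %| k)%N)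
     prefix_prod m gamma w z s k) * (1 + gamma s * ln 4) <= _); last first.
  by rewrite ler_wpM2r // addr_ge0 // mulr_ge0 // ltW.
rewrite mulrDr mulr1 lerD2l mulrCA ler_pM2l // mulrC.
exact: component_bound (ltnW sD).
Qed.

Lemma sum_set_by_max (V : nmodType) (D : nat) (F : {set 'I_D} -> V) :
  \sum_(u : {set 'I_D} | u != finset.set0) F u =
  \sum_(0 <= s < D) \sum_(u : {set 'I_D} | (\max_(j in u) j.+1)%N == s.+1) F u.
Proof.
rewrite big_mkord (exchange_big_dep (fun u : {set 'I_D} => u != finset.set0)) /=.
  apply: eq_bigr => u; rewrite -card_gt0 => u0.
  have [s su sE] := eq_bigmax_cond (fun j : 'I_D => j.+1) u0.
  by rewrite sE (big_pred1 s) // => i; rewrite eqSS eq_sym.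
by move=> s u _; apply: contraTneq => ->; rewrite big_set0.
Qed.

Lemma max_set_weight (D s : nat) (w : nat -> nat) (u : {set 'I_D}) :
  (forall j, (w j <= w j.+1)%N) -> (\max_(j in u) j.+1)%N == s.+1 ->
  (\max_(j in u) w j)%N = w s.
Proof.
move=> wS /eqP us; have wm : {homo w : i j / (i <= j)%N} by exact: (homo_leq leqnn leq_trans).
have u0 : (0 < #|u|)%N.
  rewrite lt0n; apply/negP => /eqP/cards0_eq u0.
  by move: us; rewrite u0 big_set0.
have [j ju jE] := eq_bigmax_cond (fun j : 'I_D => j.+1) u0.
have js : val j = s by move: us; rewrite jE => -[].
apply/eqP; rewrite eqn_leq; apply/andP; split.
  apply/bigmax_leqP => i iu; apply: wm; rewrite -ltnS -us.
  exact: (leq_bigmax_cond (F := fun j : 'I_D => j.+1)).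
by rewrite -js; exact: (leq_bigmax_cond (F := fun j : 'I_D => w j)).
Qed.

(** For the subsets u with maximum s the condition on k is the same, and the sum
over them is gamma_s L_s times the product over j < s of 1 + gamma_j L_j.  The
powers of ln 4 sum up in the same way. *)
Lemma log_products_bound (R : realType) (d m : nat) (gamma : nat -> R)
    (w z : nat -> nat) :
  w 0%N = 0%N -> (forall j, (w j <= w j.+1)%N) -> (forall j, 0 < gamma j) ->
  reduced_cbc_dbd m d gamma w z ->
  \sum_(u : {set 'I_(dstar m d w)} | u != finset.set0) prod_weight gamma u *
     \sum_(0 <= k < 2 ^ m | ~~ (2 ^ (m - \max_(j in u) w j) %| k)%N)
        \prod_(j in u) comp_log R m w z j k <=
  (2 ^ m)%:R * \sum_(u : {set 'I_(dstar m d w)} | u != finset.set0)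
     prod_weight gamma u * ln 4 ^+ #|u|.
Proof.
move=> w0 wS g0 alg; rewrite !sum_set_by_max mulr_sumr.
have l4 : 0 <= ln 4 :> R by rewrite ln_ge0 // ler1n.
rewrite big_nat_cond [leRHS]big_nat_cond; apply: ler_sum => s; rewrite andbT /= => sD.
rewrite (eq_bigr (fun u : {set 'I_(dstar m d w)} =>
  \sum_(0 <= k < 2 ^ m | ~~ (2 ^ (m - w s) %| k)%N)
    \prod_(j in u) (gamma j * comp_log R m w z j k))); last first.
  move=> u /(max_set_weight wS) ->; rewrite mulr_sumr; apply: eq_bigr => k _.
  by rewrite big_split.
rewrite exchange_big /=.
rewrite (eq_bigr (fun k => gamma s * (prefix_prod m gamma w z s k *
    comp_log R m w z s k))); last first.
  move=> k _; rewrite (big_set_max (fun j => gamma j * comp_log R m w z j k) sD).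
  by rewrite -mulrA [comp_log _ _ _ _ _ _ * _]mulrC.
rewrite -mulr_sumr.
rewrite (eq_bigr (fun u : {set 'I_(dstar m d w)} =>
   \prod_(j in u) (gamma j * ln 4))); last first.
  by move=> u _; rewrite big_split /= prodr_const.
rewrite (big_set_max (fun j => gamma j * ln 4) sD) mulrCA -mulrA ler_pM2l //.
apply: le_trans (component_bound w0 wS g0 alg sD) _.
by rewrite ler_wpM2l // (prefix_sum_bound (d := d)).
Qed.

(** * The cost of the truncation *)

(** Replace one factor at a time.  The additional factor B on the left avoids
the exponent size s - 1. *)
Lemma prod_diff_le (R : realDomainType) (I : eqType) (s : seq I) (a b : I -> R) (B : R) :
  0 <= B -> {in s, forall j, `|a j| <= B} -> {in s, forall j, `|b j| <= B} ->
  B * `|\prod_(j <- s) a j - \prod_(j <- s) b j| <=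
  B ^+ size s * \sum_(j <- s) `|a j - b j|.
Proof.
move=> B0; elim: s => [|i s IH] aB bB.
  by rewrite !big_nil subrr normr0 !mulr0.
have aBs : {in s, forall j, `|a j| <= B}.
  by move=> j js; rewrite aB // inE js orbT.
have bBs : {in s, forall j, `|b j| <= B}.
  by move=> j js; rewrite bB // inE js orbT.
have {}IH := IH aBs bBs.
have pa : `|\prod_(j <- s) a j| <= B ^+ size s.
  elim: s aBs {aB bB bBs IH} => [|j s IH] aB; first by rewrite big_nil normr1.
  rewrite big_cons normrM exprS ler_pM ?aB ?inE ?eqxx // IH // => l ls.
  by rewrite aB // inE ls orbT.
rewrite !big_cons /=; set A := \prod_(j <- s) a j in pa IH *.
set A' := \prod_(j <- s) b j in IH *.
have -> : a i * A - b i * A' = (a i - b i) * A + b i * (A - A') by ring.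
apply: le_trans (ler_wpM2l B0 (ler_normD _ _)) _.
rewrite [leLHS]mulrDr [leRHS]mulrDr !normrM exprS; apply: lerD.
  by rewrite -mulrA ler_wpM2l // mulrC ler_wpM2r.
rewrite mulrCA -mulrA; apply: ler_pM => //; first exact: mulr_ge0.
by rewrite bB ?inE ?eqxx.
Qed.

(** This is p B^(p-1) (X - B) <= X^p - B^p multiplied by B: a gap between B and
X outweighs the number p of factors. *)
Lemma mul_pow_gap_le (R : realDomainType) (p : nat) (B X : R) : 0 <= B -> B <= X ->
  p%:R * B ^+ p * (X - B) <= B * (X ^+ p - B ^+ p).
Proof.
move=> B0 BX; elim: p => [|p IH]; first by rewrite !mul0r expr0 subrr mulr0.
have Bp : 0 <= B ^+ p by rewrite exprn_ge0.
have D0 : 0 <= X ^+ p - B ^+ p by rewrite subr_ge0 lerXn2r ?nnegrE // (le_trans B0).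
have h : B * (p%:R * B ^+ p * (X - B)) <= X * (B * (X ^+ p - B ^+ p)).
  apply: le_trans (ler_wpM2l B0 IH) _.
  by rewrite ler_wpM2r // mulr_ge0.
have -> : B * (X ^+ p.+1 - B ^+ p.+1) =
  X * (B * (X ^+ p - B ^+ p)) + B ^+ p.+1 * (X - B) by rewrite !exprS; ring.
have -> : p.+1%:R * B ^+ p.+1 * (X - B) =
  B * (p%:R * B ^+ p * (X - B)) + B ^+ p.+1 * (X - B).
  by rewrite -natr1 exprS; ring.
by rewrite lerD2r.
Qed.

Lemma sum_mod_blocks (V : nmodType) (A B : nat) (f : nat -> V) :
  \sum_(0 <= k < A * B) f (k %% B)%N = (\sum_(0 <= r < B) f r) *+ A.
Proof.
elim: A => [|A IH]; first by rewrite mul0n big_geq.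
rewrite (big_cat_nat (n := (A * B)%N)) ?leq_mul2r ?leqnSn ?orbT //= IH mulrSr.
congr (_ + _); rewrite -{1}[(A * B)%N]add0n mulSn big_addn addnK.
by apply: eq_big_nat => r /andP[_ rB]; rewrite addnC modnMDl modn_small.
Qed.

Lemma sum_mul_mod (V : nmodType) (B z : nat) (f : nat -> V) : coprime B z ->
  \sum_(0 <= r < B) f (r * z %% B)%N = \sum_(0 <= r < B) f r.
Proof.
case: B => [|B] co; first by rewrite !big_geq.
pose h (r : 'I_B.+1) : 'I_B.+1 := inord (r * z %% B.+1).
have hE r : val (h r) = (r * z %% B.+1)%N by rewrite /= inordK // ltn_mod.
have hi : injective h.
  move=> r s /(congr1 val); rewrite !hE => /eqP rs; apply: val_inj => /=.
  wlog le : r s rs / (r <= s)%N => [H|].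
    by case/orP: (leq_total r s) => le; [apply: H|apply/esym/H => //; rewrite eq_sym].
  move: rs; rewrite eq_sym eqn_mod_dvd ?leq_mul2r ?le ?orbT // -mulnBl Gauss_dvdl //.
  move=> dv; apply/eqP; rewrite eqn_leq le /= -subn_eq0.
  have [//|sr] := posnP (s - r)%N; have := dvdn_leq sr dv.
  by rewrite leqNgt (leq_ltn_trans (leq_subr _ _)).
rewrite !big_mkord [RHS](reindex_inj hi).
by apply: eq_bigr => r _; rewrite hE.
Qed.

(** As z is odd, k z runs 2^(m-n) times through the residues modulo 2^n. *)
Lemma sum_inv_sin_grid (R : realType) (m n z : nat) : (n <= m)%N -> odd z ->
  \sum_(0 <= k < 2 ^ m | ~~ (2 ^ n %| k * z)%N)
     `|sin (grid_angle R n (k * z))|^-1 <= (2 ^ m)%:R * n%:R.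
Proof.
move=> nm oz; pose B := (2 ^ n)%N.
pose g r : R := if r == 0%N then 0 else B%:R / 2 * (r%:R^-1 + (B - r)%:R^-1).
apply: (@le_trans _ _ (\sum_(0 <= k < 2 ^ m) g ((k %% B) * z %% B)%N)).
  rewrite big_mkcond; apply: ler_sum => k _; rewrite modnMml /g -/B.
  by rewrite /dvdn; case: eqVneq => //= nz; rewrite inv_sin_grid_le.
have -> : (2 ^ m = 2 ^ (m - n) * B)%N by rewrite -expnD subnK.
rewrite (sum_mod_blocks _ _ (fun r => g (r * z %% B)%N)) sum_mul_mod; last first.
  by rewrite coprimeXl // coprime2n.
rewrite -[leLHS]mulr_natl natrM -mulrA ler_pM2l ?ltr0n ?expn_gt0 //.
rewrite big_ltn ?expn_gt0 // {1}/g eqxx add0r.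
rewrite (eq_big_nat _ _ (F2 := fun r => B%:R / 2 * (r%:R^-1 + (B - r)%:R^-1))); last first.
  by move=> r /andP[r0 _]; rewrite /g gtn_eqF.
rewrite -mulr_sumr big_split /=.
have -> : \sum_(1 <= r < B) ((B - r)%:R^-1 : R) = \sum_(1 <= r < B) r%:R^-1.
  rewrite big_nat_rev /=; apply: eq_big_nat => r /andP[r0 rB].
  by congr (_%:R^-1); lia.
rewrite -mulr2n -(mulr_natl (\sum_(1 <= r < B) _)) mulrA divfK // ler_pM2l ?ltr0n ?expn_gt0 //.
exact: harmonic_pow2.
Qed.

Lemma card_multiples (R : realType) (m n : nat) (c : R) : (n <= m)%N ->
  \sum_(0 <= k < 2 ^ m | (2 ^ n %| k)%N) c = (2 ^ m)%:R / (2 ^ n)%:R * c.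
Proof.
move=> nm; have E : (2 ^ m = 2 ^ (m - n) * 2 ^ n)%N by rewrite -expnD subnK.
rewrite big_mkcond E.
rewrite (eq_bigr (fun k => (fun r => if r == 0%N then c else 0) (k %% 2 ^ n)%N)) //.
rewrite (sum_mod_blocks _ _ (fun r => if r == 0%N then c else 0)).
rewrite big_ltn ?expn_gt0 //= big_nat big1 ?addr0 => [|r]; last first.
  by case: r.
by rewrite natrM mulfK ?mulr_natl // pnatr_eq0 -lt0n expn_gt0.
Qed.

(** A truncation of the Fourier series of [comp_log]: the frequencies l and - l
together contribute twice a term of cos_sum. *)
Definition trunc_comp_log (R : realType) (m : nat) (w z : nat -> nat) (j k : nat) : R :=
  2 * cos_sum (2 ^ (m - w j)) (grid_angle R (m - w j) (k * z j)) + ln 4.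

Lemma trunc_comp_log_le (R : realType) (m : nat) (w z : nat -> nat) (j k : nat) :
  `|trunc_comp_log R m w z j k| <= 2 * m%:R + ln 4.
Proof.
apply: le_trans (ler_normD _ _) _; apply: lerD; last first.
  by rewrite ger0_norm // ln_ge0 // ler1n.
rewrite normrM normr_nat ler_pM2l //; apply: le_trans (cos_sum_le _ _) _.
by rewrite ler_nat leq_subr.
Qed.

Lemma not_dvd_pow2_mul (n n' k z : nat) : odd z -> (n <= n')%N ->
  ~~ (2 ^ n %| k)%N -> ~~ (2 ^ n' %| k * z)%N.
Proof.
move=> oz nn; apply: contra; rewrite Gauss_dvdl; last by rewrite coprimeXl // coprime2n.
by apply: dvdn_trans; rewrite dvdn_exp2l.
Qed.

Lemma comp_log_le (R : realType) (m : nat) (w z : nat -> nat) (j k : nat) :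
  (0 < m)%N -> ~~ (2 ^ (m - w j) %| k * z j)%N ->
  `|comp_log R m w z j k| <= 2 * m%:R + ln 4.
Proof.
move=> m0 kz; rewrite ger0_norm ?log_sin_ge0 //.
apply: le_trans (log_sin_grid_le R kz) _.
have h : ((m - w j)%:R : R) <= m%:R by rewrite ler_nat leq_subr.
have l1 := ln2_le1 R; have l0 := ln2_ge R.
have n0 : (0 : R) <= (m - w j)%:R by [].
by rewrite ln4E; nra.
Qed.

(** With X = 6 m ln 2 and ln 2 >= 2/3 the gap X - B is at least 2 m / 3, so
[mul_pow_gap_le] bounds the second summand by 6 B X^p.  The total 7 B X^p is at
most 2 B X^(p+1) because X >= 4. *)
Lemma truncation_cost_le (R : realType) (m p : nat) (B : R) : (0 < m)%N ->
  B = 2 * m%:R + ln 4 ->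
  B * B ^+ p + B ^+ p * (p%:R * (4 * m%:R)) <=
  B * (2 * (6 * (m%:R * ln 2)) ^+ p.+1).
Proof.
move=> m0 BE; set X := 6 * (m%:R * ln 2).
have m1 : (1 : R) <= m%:R by rewrite ler1n.
have l1 := ln2_le1 R; have l0 := ln2_ge R.
rewrite ln4E in BE.
have B0 : 0 <= B by rewrite BE; nra.
have XB : 2 * m%:R <= 3 * (X - B) by rewrite BE /X; nra.
have X4 : 4 <= X by rewrite /X; nra.
have BX : B <= X by nra.
have h := mul_pow_gap_le p B0 BX.
have Bp : 0 <= B ^+ p by rewrite exprn_ge0.
have BXp : B ^+ p <= X ^+ p by rewrite lerXn2r ?nnegrE // (le_trans B0).
have pB : 0 <= p%:R * B ^+ p by rewrite mulr_ge0.
have h1 : B ^+ p * (p%:R * (4 * m%:R)) <= 6 * (p%:R * B ^+ p * (X - B)).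
  rewrite (_ : B ^+ p * _ = 2 * (p%:R * B ^+ p * (2 * m%:R))); last by ring.
  rewrite (_ : 6 * _ = 2 * (p%:R * B ^+ p * (3 * (X - B)))); last by ring.
  by rewrite ler_pM2l // ler_wpM2l.
have h2 : 8 * X ^+ p <= 2 * X ^+ p.+1.
  rewrite exprS mulrA ler_wpM2r //; last lra.
  by rewrite exprn_ge0 // (le_trans B0).
have h3 := ler_wpM2l B0 h2; have h4 := ler_wpM2l B0 BXp.
have h5 : 0 <= B * B ^+ p by rewrite mulr_ge0.
lra.
Qed.

(** Residues divisible by 2^n have density 1 / 2^n, and B bounds each factor
there.  At the others no angle of u is a multiple of pi; the pointwise errors
4 / (2^n_j |sin|) have mean at most 4 n_j / 2^n_j, and n <= n_j <= m. *)
Lemma trunc_product_bound (R : realType) (m D : nat) (w z : nat -> nat)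
    (u : {set 'I_D}) (n : nat) : (0 < m)%N ->
  (forall j, (j < D)%N -> odd (z j)) ->
  n = (m - \max_(j in u) w j)%N ->
  \sum_(0 <= k < 2 ^ m) \prod_(j in u) trunc_comp_log R m w z j k <=
  \sum_(0 <= k < 2 ^ m | ~~ (2 ^ n %| k)%N) \prod_(j in u) comp_log R m w z j k +
  (2 ^ m)%:R * (2 * (6 * ln (2 ^ m)%:R) ^+ #|u|.+1 / 2 ^+ n).
Proof.
move=> m0 oz nE; set B : R := 2 * m%:R + ln 4.
have B0 : 0 < B.
  by rewrite addr_gt0 ?mulr_gt0 ?ltr0n ?ln_gt0 // ltr1n.
have nm : (n <= m)%N by rewrite nE leq_subr.
have nj j : j \in u -> (n <= m - w j)%N.
  move=> ju; rewrite nE; apply: leq_sub2l.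
  exact: (leq_bigmax_cond (F := fun j : 'I_D => w j)).
have N0 : (0 : R) < (2 ^ m)%:R by rewrite ltr0n expn_gt0.
have n0 : (0 : R) < (2 ^ n)%:R by rewrite ltr0n expn_gt0.
set Q : R := (2 ^ m)%:R / (2 ^ n)%:R.
have Q0 : 0 <= Q by rewrite divr_ge0.
have big_k : \sum_(0 <= k < 2 ^ m | (2 ^ n %| k)%N)
    \prod_(j in u) trunc_comp_log R m w z j k <= Q * B ^+ #|u|.
  rewrite -card_multiples //; apply: ler_sum => k _.
  apply: le_trans (ler_norm _) _; rewrite normr_prod -prodr_const.
  by apply: ler_prod => j _; rewrite normr_ge0 trunc_comp_log_le.
have diff_k k : ~~ (2 ^ n %| k)%N ->
    B * (\prod_(j in u) trunc_comp_log R m w z j k - \prod_(j in u) comp_log R m w z j k)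
    <= B ^+ #|u| * \sum_(j in u) (4 / (2 ^ (m - w j))%:R *
        `|sin (grid_angle R (m - w j) (k * z j))|^-1).
  move=> kn; have kj j : j \in u -> ~~ (2 ^ (m - w j) %| k * z j)%N.
    by move=> ju; apply: not_dvd_pow2_mul kn; [apply: oz|apply: nj].
  apply: le_trans (ler_wpM2l (ltW B0) (ler_norm _)) _.
  rewrite -!(big_enum _ _ u) /= cardE.
  apply: le_trans (prod_diff_le (ltW B0) _ _) _ => [j _|j|].
  - exact: trunc_comp_log_le.
  - by rewrite mem_enum => ju; apply: comp_log_le => //; apply: kj.
  rewrite ler_pM2l ?exprn_gt0 //.
  rewrite big_seq [leRHS]big_seq; apply: ler_sum => j; rewrite mem_enum => ju.
  exact: log_sin_trunc_error (kj j ju).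
have sum_diff : \sum_(0 <= k < 2 ^ m | ~~ (2 ^ n %| k)%N)
    \sum_(j in u) (4 / (2 ^ (m - w j))%:R *
        `|sin (grid_angle R (m - w j) (k * z j))|^-1) <= Q * (#|u|%:R * (4 * m%:R)).
  rewrite exchange_big /= mulr_natl -sumr_const mulr_sumr; apply: ler_sum => j ju.
  rewrite -mulr_sumr.
  apply: (@le_trans _ _ (4 / (2 ^ (m - w j))%:R * ((2 ^ m)%:R * (m - w j)%:R))).
    rewrite ler_wpM2l ?divr_ge0 //.
    apply: le_trans (sum_inv_sin_grid R (leq_subr _ _) (oz j (ltn_ord j))).
    rewrite big_mkcond [leRHS]big_mkcond; apply: ler_sum => k _.
    case: ifP => [kn|_]; last by case: ifP.
    by rewrite (not_dvd_pow2_mul (oz j (ltn_ord j)) (nj j ju) kn).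
  rewrite (_ : _ * _ = 4 * (2 ^ m)%:R * ((2 ^ (m - w j))%:R^-1 * (m - w j)%:R));
    last by ring.
  rewrite (_ : Q * _ = 4 * (2 ^ m)%:R * ((2 ^ n)%:R^-1 * m%:R)); last by rewrite /Q; ring.
  rewrite ler_pM2l ?mulr_gt0 // ler_pM ?ler_nat ?leq_subr //.
  by rewrite lef_pV2 ?posrE ?ltr0n ?expn_gt0 // ler_nat leq_exp2l // nj.
rewrite (bigID (fun k => (2 ^ n %| k)%N)) /=.
rewrite [X in _ + X <= _](_ : _ = \sum_(0 <= k < 2 ^ m | ~~ (2 ^ n %| k)%N)
     \prod_(j in u) comp_log R m w z j k +
   \sum_(0 <= k < 2 ^ m | ~~ (2 ^ n %| k)%N)
     (\prod_(j in u) trunc_comp_log R m w z j k - \prod_(j in u) comp_log R m w z j k));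
  last by rewrite -big_split /=; apply: eq_bigr => k _; rewrite addrC subrK.
rewrite addrCA lerD2l -(ler_pM2l B0) mulrDr.
have h1 : B * \sum_(0 <= k < 2 ^ m | ~~ (2 ^ n %| k)%N)
     (\prod_(j in u) trunc_comp_log R m w z j k - \prod_(j in u) comp_log R m w z j k)
   <= B ^+ #|u| * (Q * (#|u|%:R * (4 * m%:R))).
  rewrite mulr_sumr; apply: le_trans (ler_sum _ diff_k) _.
  by rewrite -mulr_sumr ler_pM2l ?exprn_gt0.
apply: le_trans (lerD (ler_wpM2l (ltW B0) big_k) h1) _.
have := ler_wpM2l Q0 (@truncation_cost_le R m #|u| B m0 erefl).
rewrite -/B (_ : ln (2 ^ m)%:R = m%:R * ln 2); last first.
  by rewrite natrX lnXn // -(mulr_natl (ln 2)).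
rewrite /Q natrX [(2 ^ n)%:R]natrX; move=> h.
apply: le_trans (le_trans _ h) _; rewrite le_eqVlt; apply/orP; left; apply/eqP; ring.
Qed.

(** * Averages of characters and products of cosine sums *)

Lemma cosD_int2pi (R : realType) (x : R) (b : int) :
  cos (x + b%:~R * (2 * pi)) = cos x.
Proof.
have E (n : nat) (y : R) : cos (y + n%:R * (2 * pi)) = cos y.
  by rewrite (mulr_natl pi) (mulr_natl (pi *+ 2)) (periodicn (@cosD2pi R)).
case: b => n; first exact: E.
by rewrite NegzE mulrNz mulNr -[LHS](E n.+1) subrK.
Qed.

Lemma sum_cos_dvd (R : realType) (m : nat) (a : int) : ((2 ^ m)%N%:Z %| a)%Z ->
  \sum_(0 <= k < 2 ^ m) cos (k%:R * (2 * pi * (a%:~R / 2 ^+ m))) = (2 ^ m)%:R :> R.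
Proof.
move=> /dvdzP[q ->]; rewrite -[X in _ = X%:R](subn0 (2 ^ m)%N) -sumr_const_nat.
apply: eq_bigr => k _.
rewrite (_ : _ * _ = 0 + (k%:Z * q)%:~R * (2 * pi)) ?cosD_int2pi ?cos0 //.
rewrite add0r !intrM -[(2 ^ m)%N%:~R]/((2 ^ m)%N%:R) natrX; field.
by rewrite expf_neq0.
Qed.

(** Pairing k with k + 2^m gives twice the sum for a / 2 if a is even, and
cancels if a is odd. *)
Lemma sum_cos_ge0 (R : realType) (m : nat) (a : int) :
  0 <= \sum_(0 <= k < 2 ^ m) cos (k%:R * (2 * pi * (a%:~R / 2 ^+ m))) :> R.
Proof.
elim: m a => [|m IH] a; first by rewrite expn0 big_nat1 mul0r cos0.
set al := 2 * pi * _.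
have N0 : (0 < 2 ^ m)%N by rewrite expn_gt0.
have -> : \sum_(0 <= k < 2 ^ m.+1) cos (k%:R * al) =
  \sum_(0 <= k < 2 ^ m) (cos (k%:R * al) + cos (k%:R * al + a%:~R * pi)).
  rewrite expnS mul2n -addnn (big_cat_nat (n := (2 ^ m)%N)) ?leq_addr //=.
  rewrite big_split /=; congr (_ + _).
  rewrite -{1}[(2 ^ m)%N]add0n big_addn addnK; apply: eq_bigr => k _.
  congr cos; rewrite natrD natrX /al exprS; field.
  by rewrite expf_neq0.
have [b [aE|aE]] : exists b : int, a = b * 2 \/ a = b * 2 + 1.
  exists (a %/ 2)%Z; have := divz_eq a 2; have := modz_ge0 a (d := 2) isT.
  have := ltz_mod a (d := 2) isT; lia.
- have h := IH b; apply: le_trans (mulr_ge0 (ler0n R 2) h) _.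
  rewrite mulr_sumr le_eqVlt; apply/orP; left; apply/eqP; apply: eq_bigr => k _.
  rewrite [in RHS]aE.
  rewrite (_ : (b * 2)%:~R * pi = b%:~R * (2 * pi) :> R); last first.
    by rewrite intrM mulrA.
  rewrite cosD_int2pi -mulr2n mulr_natl; congr (cos _ *+ 2).
  rewrite /al aE intrM exprS; field.
  by rewrite expf_neq0.
- rewrite big1 // => k _.
  rewrite (_ : a%:~R * pi = pi + b%:~R * (2 * pi)); last first.
    by rewrite aE intrD intrM /=; ring.
  by rewrite addrA cosD_int2pi cosDpi subrr.
Qed.

Definition cis (R : realType) (x : R) : R[i] := (cos x +i* sin x)%C.

Lemma cisD (R : realType) (x y : R) : cis (x + y) = cis x * cis y.
Proof.
rewrite /cis cosD sinD; apply/eqP; rewrite eq_complex /=.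
by rewrite eqxx /= addrC.
Qed.

(** Distribute the product over j of the complex sums of A j i cis (v_i
theta_j).  The sine sums vanish, so these sums are real, and real parts can be
compared. *)
Lemma cos_product_expand (R : realType) (d K : nat) (A : 'I_d -> 'I_K -> R)
    (v : 'I_K -> int) (theta : 'I_d -> R) :
  (forall j, \sum_i A j i * sin ((v i)%:~R * theta j) = 0) ->
  \sum_(f : {ffun 'I_d -> 'I_K}) (\prod_j A j (f j)) *
     cos (\sum_j (v (f j))%:~R * theta j) =
  \prod_j \sum_i A j i * cos ((v i)%:~R * theta j).
Proof.
move=> odd0; pose F j i : R[i] := ((A j i)%:C)%C * cis ((v i)%:~R * theta j).
have ReD : {morph @complex.Re R : x y / x + y >-> x + y} by case=> ? ? [].
have FE j : \sum_i F j i = ((\sum_i A j i * cos ((v i)%:~R * theta j))%:C)%C.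
  apply/eqP; rewrite eq_complex; apply/andP; split; apply/eqP.
    rewrite (big_morph _ ReD (erefl : complex.Re 0 = 0)) /=.
    by apply: eq_bigr => i _; rewrite /= mul0r subr0.
  have ImD : {morph @complex.Im R : x y / x + y >-> x + y} by case=> ? ? [].
  rewrite (big_morph _ ImD (erefl : complex.Im 0 = 0)) /= -[RHS](odd0 j).
  by apply: eq_bigr => i _; rewrite /= mul0r addr0.
have prodC (G : 'I_d -> R) : \prod_j ((G j)%:C)%C = ((\prod_j G j)%:C)%C.
  by rewrite rmorph_prod.
have : \prod_j \sum_i F j i = \sum_(f : {ffun 'I_d -> 'I_K}) \prod_j F j (f j).
  exact: bigA_distr_bigA.
rewrite (eq_bigr _ (fun j _ => FE j)) prodC.
move=> /(congr1 (@complex.Re R)) /= ->.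
rewrite (big_morph _ ReD (erefl : complex.Re 0 = 0)); apply: eq_bigr => f _.
rewrite big_split /= prodC.
have -> : \prod_j cis ((v (f j))%:~R * theta j) = cis (\sum_j (v (f j))%:~R * theta j).
  rewrite (big_morph _ (@cisD R) (_ : cis 0 = 1)) //.
  by rewrite /cis cos0 sin0.
by rewrite /= mul0r subr0.
Qed.

Lemma sum_symmetric_range (V : nmodType) (N M : nat) (g : int -> V) :
  (0 < M <= N)%N -> (forall a, (M <= `|a|)%N -> g a = 0) ->
  \sum_(0 <= i < N.*2) g (i%:Z - N%:Z) =
  g 0 + \sum_(1 <= l < M) (g l%:Z + g (- l%:Z)).
Proof.
case/andP=> M0 MN g0; have N0 : (0 < N)%N by exact: leq_trans M0 MN.
have trunc N' (h : nat -> V) : (M <= N')%N -> (forall l, (M <= l)%N -> h l = 0) ->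
    \sum_(1 <= l < N') h l = \sum_(1 <= l < M) h l.
  move=> MN' h0; rewrite (big_cat_nat (n := M)) //= [X in _ + X]big_nat [X in _ + X]big1 ?addr0 // => l.
  by case/andP=> /h0.
rewrite (big_cat_nat (n := N)) -?addnn ?leq_addr //=.
rewrite -{3}[N]add0n big_addn addnK [X in _ + X]big_ltn //.
rewrite add0n subrr addrCA; congr (_ + _); rewrite big_split /= addrC; congr (_ + _).
  rewrite -(trunc N) => [|//|l Ml]; last by rewrite g0.
  by apply: eq_big_nat => l _; congr g; rewrite PoszD addrK.
rewrite -(trunc N.+1) => [||l Ml]; [|exact: leqW|by rewrite g0 ?abszN].
rewrite big_nat_rev big_add1 /= add0n; apply: eq_big_nat => l /andP[_ lN].
by congr g; lia.
Qed.

(** * The quality measure as an average over residues *)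

(** Frequencies are represented by ordinals, so that products of sums can be
distributed over finite functions; the range from - 2^m to 2^m - 1 contains all
components of the frequency box. *)
Definition shift_int (m : nat) (i : 'I_(2 ^ m).*2) : int := i%:Z - (2 ^ m)%N%:Z.

Definition shift_ffun (m d : nat) (f : {ffun 'I_d -> 'I_(2 ^ m).*2}) :
    {ffun 'I_d -> int} := [ffun j => shift_int (f j)].

Lemma shift_ffun_inj (m d : nat) : injective (@shift_ffun m d).
Proof.
move=> f g /ffunP fg; apply/ffunP => j; have := fg j.
by rewrite !ffunE => /addIr [] /val_inj.
Qed.

Lemma quality_TE (R : realType) (m d : nat) (gamma : nat -> R)
    (z : 'I_d -> nat) (w : nat -> nat) :
  quality_T m gamma z w =
  \sum_(f : {ffun 'I_d -> 'I_(2 ^ m).*2} | shift_ffun f \in (freq_box m w `\ 0)%classic)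
     delta R (2 ^ m) (\sum_(j < d) shift_ffun f j * (z j)%:Z) /
     r1 gamma (shift_ffun f).
Proof.
pose r := [seq shift_ffun f | f <- enum [pred f : {ffun 'I_d -> 'I_(2 ^ m).*2} |
   shift_ffun f \in (freq_box m w `\ 0)%classic]].
rewrite /quality_T (fsbigE r).
- rewrite big_map big_enum_cond /=; apply: eq_bigl => f.
  by rewrite inE andbb.
- by rewrite map_inj_uniq ?enum_uniq //; exact: shift_ffun_inj.
- by move=> l /= /mapP[f]; rewrite mem_enum => fP ->; apply/set_mem; exact: fP.
- move=> l lP /negP[]; have [lbox _] := lP.
  have bound j : (`|(l j + (2 ^ m)%N%:Z)%R|%N < (2 ^ m).*2)%N /\ 0 <= l j + (2 ^ m)%N%:Z.
    have /andP[lo hi] := lbox j.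
    have le2 : (2 ^+ (m - w j) : int) <= (2 ^ m)%N%:Z.
      by rewrite -natz natrX ler_eXn2l ?leq_subr.
    move: lo hi le2; move: (2 ^+ (m - w j) : int) (l j) (2 ^ m)%N => a b N lo hi le2.
    by rewrite -addnn; split; lia.
  apply/mapP; exists [ffun j => Ordinal (bound j).1].
    rewrite mem_enum inE (_ : shift_ffun _ = l) ?inE //.
    by apply/ffunP => j; rewrite !ffunE /shift_int /= gez0_abs ?addrK // (bound j).2.
  by apply/ffunP => j; rewrite !ffunE /shift_int /= gez0_abs ?addrK // (bound j).2.
Qed.

(** The Fourier coefficients of the function c + g (2 cos_sum M). *)
Definition coef (R : realType) (M : nat) (c g : R) (a : int) : R :=
  if a == 0 then c else if (`|a| < M)%N then g / `|a|%N%:R else 0.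

Lemma coef_ge0 (R : realType) (M : nat) (c g : R) (a : int) :
  0 <= c -> 0 <= g -> 0 <= coef M c g a.
Proof.
move=> c0 g0; rewrite /coef; case: ifP => // _; case: ifP => // _.
exact: divr_ge0.
Qed.

Lemma sum_coef_sin (R : realType) (m M : nat) (c g x : R) : (0 < M <= 2 ^ m)%N ->
  \sum_(i < (2 ^ m).*2) coef M c g (shift_int i) * sin ((shift_int i)%:~R * x) = 0.
Proof.
move=> MN; rewrite -(big_mkord xpredT (fun i => (fun a : int =>
  coef M c g a * sin (a%:~R * x)) (i%:Z - (2 ^ m)%N%:Z))).
have [M0 _] := andP MN.
rewrite (@sum_symmetric_range _ _ _ (fun a => coef M c g a * sin (a%:~R * x)) MN) => [|a Ma]; last first.
  rewrite /coef; case: eqVneq Ma => [->|_ Ma]; first by rewrite leqNgt M0.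
  by rewrite ltnNge Ma mul0r.
rewrite mul0r sin0 mulr0 add0r big1 // => l _.
by rewrite mulrNz mulNr sinN mulrN /coef oppr_eq0 abszN subrr.
Qed.

Lemma sum_coef_cos (R : realType) (m M : nat) (c g x : R) : (0 < M <= 2 ^ m)%N ->
  \sum_(i < (2 ^ m).*2) coef M c g (shift_int i) * cos ((shift_int i)%:~R * (2 * x)) =
  c + g * (2 * cos_sum M x).
Proof.
move=> MN; rewrite -(big_mkord xpredT (fun i => (fun a : int =>
  coef M c g a * cos (a%:~R * (2 * x))) (i%:Z - (2 ^ m)%N%:Z))).
have [M0 _] := andP MN.
rewrite (@sum_symmetric_range _ _ _ (fun a => coef M c g a * cos (a%:~R * (2 * x))) MN) => [|a Ma]; last first.
  rewrite /coef; case: eqVneq Ma => [->|_ Ma]; first by rewrite leqNgt M0.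
  by rewrite ltnNge Ma mul0r.
rewrite mul0r cos0 mulr1 {1}/coef eqxx; congr (_ + _).
rewrite /cos_sum !mulr_sumr; apply: eq_big_nat => l /andP[l0 lM].
rewrite mulrNz mulNr cosN /coef oppr_eq0 abszN /= lM.
rewrite (_ : (l%:Z == 0) = false) ?eqz_nat ?gtn_eqF //.
by rewrite -[l%:~R]/(l%:R); ring.
Qed.

(** The right-hand side is a sum over all frequencies of nonnegative
coefficients times averaged characters.  The zero frequency gives the product
of the c j.  The nonzero frequencies of the box give at least T, because
c j >= 1 and the averaged character dominates delta.  The others are
nonnegative. *)
Lemma fourier_bound (R : realType) (m d : nat) (gamma c : nat -> R)
    (w z : nat -> nat) :
  (forall j, 0 < gamma j) -> (forall j, 1 <= c j) ->
  quality_T m gamma (@generating_vector d w z) w + \prod_(j < d) c j <=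
  (2 ^ m)%:R^-1 * \sum_(0 <= k < 2 ^ m) \prod_(j < d)
    (c j + gamma j * (2 * cos_sum (2 ^ (m - w j))
        (pi * (k%:R * (2 ^ w j * z j)%:R / 2 ^+ m)))).
Proof.
move=> g0 c1; pose zv : 'I_d -> nat := @generating_vector d w z.
have c0 j : 0 <= c j by apply: le_trans (c1 j).
have N0 : (0 : R) < (2 ^ m)%:R by rewrite ltr0n expn_gt0.
pose A (j : 'I_d) (i : 'I_(2 ^ m).*2) :=
  coef (2 ^ (m - w j)) (c j) (gamma j) (shift_int i).
pose dot (f : {ffun 'I_d -> 'I_(2 ^ m).*2}) : int :=
  \sum_(j < d) shift_ffun f j * (zv j)%:Z.
(* the averaged character: 1 on the multiples of 2^m, nonnegative elsewhere *)
pose kernel (a : int) : R :=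
  (2 ^ m)%:R^-1 * \sum_(0 <= k < 2 ^ m) cos (k%:R * (2 * pi * (a%:~R / 2 ^+ m))).
have kernel_ge0 a : 0 <= kernel a by rewrite mulr_ge0 ?invr_ge0 ?sum_cos_ge0 // ltW.
have kernel_delta a : delta R (2 ^ m) a <= kernel a.
  rewrite /delta; case: ifP => [dv|_]; last exact: kernel_ge0.
  by rewrite /kernel sum_cos_dvd // mulVf // gt_eqF.
have MN j : (0 < 2 ^ (m - w j) <= 2 ^ m)%N.
  by rewrite expn_gt0 /= leq_exp2l // leq_subr.
have A0 f : 0 <= \prod_(j < d) A j (f j).
  by apply: prodr_ge0 => j _; apply: coef_ge0 => //; exact: ltW.
have -> : (2 ^ m)%:R^-1 * \sum_(0 <= k < 2 ^ m) \prod_(j < d)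
    (c j + gamma j * (2 * cos_sum (2 ^ (m - w j))
        (pi * (k%:R * (2 ^ w j * z j)%:R / 2 ^+ m)))) =
  \sum_(f : {ffun 'I_d -> 'I_(2 ^ m).*2}) (\prod_(j < d) A j (f j)) * kernel (dot f).
  rewrite (eq_bigr (fun k => \sum_(f : {ffun 'I_d -> 'I_(2 ^ m).*2})
     (\prod_(j < d) A j (f j)) * cos (k%:R * (2 * pi * ((dot f)%:~R / 2 ^+ m))))).
    rewrite exchange_big mulr_sumr; apply: eq_bigr => f _ /=.
    by rewrite -mulr_sumr mulrCA.
  move=> k _; rewrite (eq_bigr (fun j : 'I_d => \sum_i A j i *
     cos ((shift_int i)%:~R * (2 * (pi * (k%:R * (2 ^ w j * z j)%:R / 2 ^+ m)))))).
    rewrite -cos_product_expand => [|j]; last exact: sum_coef_sin.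
    apply: eq_bigr => f _; congr (_ * cos _).
    rewrite /dot rmorph_sum /= mulr_suml !mulr_sumr; apply: eq_bigr => j _.
    rewrite ffunE intrM /zv /generating_vector.
    by rewrite -[(2 ^ _ * _)%N%:~R]/((2 ^ w j * z j)%N%:R); ring.
  by move=> j _; rewrite /A sum_coef_cos.
have Nlt : (2 ^ m < (2 ^ m).*2)%N by rewrite -addnn -[X in (X < _)%N]addn0 ltn_add2l expn_gt0.
pose f0 : {ffun 'I_d -> 'I_(2 ^ m).*2} := [ffun=> Ordinal Nlt].
have f0E : shift_ffun f0 = 0.
  by apply/ffunP => j; rewrite !ffunE /shift_int /= subrr.
rewrite (bigD1 f0) //= addrC; apply: lerD; last first.
  have -> : kernel (dot f0) = 1.
    have -> : dot f0 = 0 by rewrite /dot f0E big1 // => j _; rewrite ffunE mul0r.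
    by rewrite /kernel sum_cos_dvd ?dvdz0 // mulVf // gt_eqF.
  rewrite mulr1; apply: ler_prod => j _; rewrite c0 /=.
  rewrite /A /coef -[shift_int _](ffunE (fun j => shift_int (f0 j))).
  by rewrite -/(shift_ffun f0) f0E ffunE eqxx.
rewrite quality_TE big_mkcond [leRHS]big_mkcond; apply: ler_sum => f _.
case: ifP => [|_]; last first.
  by case: ifP => // _; rewrite mulr_ge0.
rewrite inE => -[fbox fn0].
have -> : f != f0 by apply/eqP => ff; apply: fn0; rewrite ff f0E.
rewrite -/(dot f) mulrC; apply: ler_pM; rewrite ?kernel_delta //.
- rewrite invr_ge0; apply: prodr_ge0 => j _.
  by rewrite mulr_ge0 // ?invr_ge0 ?ler0z // ltW.
- by rewrite /delta; case: ifP.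
rewrite /r1 -prodfV big_mkcond; apply: ler_prod => j _.
have := fbox j; rewrite /A /coef ffunE; case: eqVneq => [_ _|fj] /=; first by rewrite ler01 c1.
move=> /andP[lo hi]; rewrite invr_ge0 mulr_ge0 ?invr_ge0 ?ler0z // ?(ltW (g0 j)) //=.
have -> : (`|shift_int (f j)| < 2 ^ (m - w j))%N.
  have pE : ((2 ^ (m - w j))%N%:Z = 2 ^+ (m - w j) :> int) by rewrite -natz natrX.
  move: lo hi pE; move: (2 ^+ (m - w j) : int) (2 ^ (m - w j))%N (shift_int _) => a b x.
  lia.
by rewrite invfM invrK -abszE.
Qed.

(** * Assembling the bound *)

Lemma big_set_all (R : comNzRingType) (D : nat) (x : nat -> R) :
  \prod_(j < D) (1 + x j) = \sum_(u : {set 'I_D}) \prod_(j in u) x j.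
Proof.
rewrite (eq_bigr (fun j : 'I_D => x j + 1)) => [|j _]; last exact: addrC.
rewrite bigA_distr; apply: eq_bigr => u _.
by rewrite [RHS]big_mkcond.
Qed.

Lemma dstar_le (m d : nat) (w : nat -> nat) : (dstar m d w <= d)%N.
Proof. by apply/bigmax_leqP => j _. Qed.

Lemma prod_ord_dstar (R : comNzRingType) (m d : nat) (w : nat -> nat) (F : nat -> R) :
  \prod_(j < d) (if (j < dstar m d w)%N then F j else 1) =
  \prod_(j < dstar m d w) F j.
Proof. by rewrite -big_mkcond /= [RHS](big_ord_widen _ F (dstar_le m d w)). Qed.

(** Take c j = 1 + gamma_j ln 4 for the coordinates below d^* and c j = 1 for
the others, whose cosine sums are empty.  The terms of the empty set cancel. *)
Lemma quality_T_le_trunc (R : realType) (d m : nat) (gamma : nat -> R)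
    (w z : nat -> nat) :
  (forall j, (w j <= w j.+1)%N) -> (forall j, 0 < gamma j) ->
  quality_T m gamma (@generating_vector d w z) w <=
  \sum_(u : {set 'I_(dstar m d w)} | u != finset.set0) prod_weight gamma u *
    ((2 ^ m)%:R^-1 * \sum_(0 <= k < 2 ^ m) \prod_(j in u) trunc_comp_log R m w z j k
     - ln 4 ^+ #|u|).
Proof.
move=> wS g0; set D := dstar m d w.
have l4 : 0 <= ln 4 :> R by rewrite ln_ge0 // ler1n.
have N0 : (0 : R) < (2 ^ m)%:R by rewrite ltr0n expn_gt0.
pose c j : R := if (j < D)%N then 1 + gamma j * ln 4 else 1.
have c1 j : 1 <= c j.
  by rewrite /c; case: ifP => // _; rewrite lerDl mulr_ge0 // ltW.
have := @fourier_bound R m d gamma c w z g0 c1.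
have -> : \prod_(j < d) c j =
    \sum_(u : {set 'I_D}) \prod_(j in u) (gamma j * ln 4).
  rewrite -(big_set_all D (fun j => gamma j * ln 4)).
  exact: (prod_ord_dstar m d w (fun j => 1 + gamma j * ln 4)).
rewrite (eq_bigr (fun k => \sum_(u : {set 'I_D})
    prod_weight gamma u * \prod_(j in u) trunc_comp_log R m w z j k)); last first.
  move=> k _; rewrite (eq_bigr (fun j : 'I_d => if (j < D)%N then
     1 + gamma j * trunc_comp_log R m w z j k else 1)).
    rewrite (prod_ord_dstar m d w (fun j => 1 + gamma j * trunc_comp_log R m w z j k)).
    rewrite (big_set_all _ (fun j => gamma j * trunc_comp_log R m w z j k)).
    by apply: eq_bigr => u _; rewrite big_split.
  move=> j _; rewrite /c; case: ifP => jD.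
    have /andP[jm _] := dstar_bound wS jD.
    rewrite /trunc_comp_log [X in cos_sum _ X](_ : _ = grid_angle R (m - w j) (k * z j)).
      by ring.
    rewrite /grid_angle !natrM natrX -{1}(subnK (ltnW jm)) exprD; field.
    by rewrite !expf_neq0.
  have /eqP -> : (m - w j == 0)%N.
    by rewrite subn_eq0; apply: dstar_full (_ : (D <= j < d)%N); rewrite leqNgt jD /=.
  by rewrite /cos_sum expn0 big_geq // !mulr0 addr0.
rewrite exchange_big mulr_sumr -lerBrDr -sumrB.
rewrite (bigD1 finset.set0) //= !big_set0 /prod_weight.
rewrite [X in _ * X - _ + _](eq_bigr (fun=> 1)) => [|k _]; last by rewrite !big_set0 mulr1.
rewrite sumr_const_nat subn0 mulVf ?gt_eqF // subrr add0r => /le_trans; apply.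
rewrite le_eqVlt; apply/orP; left; apply/eqP; apply: eq_bigr => u _.
rewrite -mulr_sumr big_split /= prodr_const; ring.
Qed.

Theorem theorem4 (R : realType) (d m : nat) (w : nat -> nat) (gamma : nat -> R)
    (z : nat -> nat) :
  (0 < d)%N -> (0 < m)%N ->
  w 0%N = 0%N -> (forall j : nat, (w j <= w j.+1)%N) ->
  (forall j : nat, 0 < gamma j) ->
  reduced_cbc_dbd m d gamma w z ->
  quality_T m gamma (@generating_vector d w z) w <=
  \sum_(u : {set 'I_(dstar m d w)} | u != finset.set0)
    prod_weight gamma u *
    (2 * (6 * ln ((2 ^ m)%N%:R)) ^+ (#|u|.+1) /
     2 ^+ (m - \max_(j in u) w j)%N).
Proof.
move=> _ m0 w0 wS g0 alg; apply: le_trans (quality_T_le_trunc d m z wS g0) _.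
have N0 : (0 : R) < (2 ^ m)%:R by rewrite ltr0n expn_gt0.
have Ni : 0 < (2 ^ m)%:R^-1 :> R by rewrite invr_gt0.
have logs := log_products_bound w0 wS g0 alg.
rewrite -subr_le0 mulr_sumr -sumrB -(pmulr_rle0 _ Ni) mulr_sumr in logs.
rewrite -subr_le0 -sumrB; apply: le_trans logs; apply: ler_sum => u _.
have gu : 0 <= prod_weight gamma u by apply: prodr_ge0 => j _; exact: ltW.
have h := trunc_product_bound R (w := w) (u := u) m0
  (fun j => cbc_dbd_odd wS alg) erefl.
rewrite -(ler_pM2l Ni) [leRHS]mulrDr mulKf ?gt_eqF // in h.
have {}h := ler_wpM2l gu h; rewrite [leRHS]mulrDr in h.
rewrite [leRHS]mulrBr mulKf ?gt_eqF // mulrBr [leRHS]addrC [_^-1 * (_ * _)]mulrCA.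
lra.
Qed.
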